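(* Let $\mathcal Q=\{1,\dots,N\}$, $T>0$, $\eta\ge0$, and let $\tilde A_q\in\mathbb R^{n\times n}$, $B_q\in\mathbb R^{n\times n_2}$ ($q\in\mathcal Q$), $H\in\mathbb R^{n_2\times n}$, $L\in\mathbb R^{n_2\times n_2}$, and let $\lambda_q\ge0$ ($q\in\mathcal Q$) with $\sum_{q\in\mathcal Q}\lambda_q=1$. For $\varepsilon>0$ consider the stochastic hybrid system $\mathcal H_\varepsilon$ with state $(x,z)$, $x=(\xi,q,\tau)\in\mathbb R^n\times\mathcal Q\times[0,T]$, $z\in\mathbb R^{n_2}$: $$(x,z)\in C:\quad \dot\xi=\tilde A_q\xi+B_qz,\quad\dot q=0,\quad\dot\tau\in[-\eta,0],\quad\varepsilon\dot z=H\xi+Lz,$$ $$(x,z)\in D:\quad \xi^+=\xi,\quad q^+=v_1,\quad\tau^+=v_2,\quad z^+=z,\qquad v=(v_1,v_2)\sim\mu=\mu_1\times\mu_2,$$ where $C=\mathbb R^n\times\mathcal Q\times[0,T]\times\mathbb R^{n_2}$, $D=\mathbb R^n\times\mathcal Q\times\{0\}\times\mathbb R^{n_2}$, $\mu_1=\sum_{q\in\mathcal Q}\lambda_q\delta_q$, and $\mu_2$ is the uniform distribution on $[0,T]$. Assume that there exist $\sigma>0$, symmetric positive definite matrices $\{P_q\}_{q\in\mathcal Q}$, and a (symmetric) positive definite matrix $P_z$ such that, with $A_q:=\tilde A_q-B_qL^{-1}H$ and $P:=\sum_{q\in\mathcal Q}\lambda_qP_q$, for all $q\in\mathcal Q$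 $$A_q^\top P_q+P_qA_q+\sigma\eta T^{-1}P_q\prec0,\qquad \sigma^{-1}\log(1+\sigma)P-P_q\prec0,\qquad L^\top P_z+P_zL\prec0.$$ Let $\tilde{\mathcal A}:=\mathcal A\times\{0\}$ with $\mathcal A:=\{0\}\times\mathcal Q\times[0,T]$ (so $\tilde{\mathcal A}$ is the set of states with $\xi=0$, $z=0$). Then there exists $\varepsilon^*\in(0,\infty)$ such that for all $\varepsilon\in(0,\varepsilon^* )$ the system $\mathcal H_\varepsilon$ renders the set $\tilde{\mathcal A}$ Uniformly Globally Asymptotically Stable in Probability (UGASp).
   Context: $M\prec0$ means that the symmetric matrix $M$ is negative definite; $\delta_q$ is the Dirac measure at $q$; $|y|_S:=\inf_{s\in S}\|y-s\|$; $\mathbb B^\circ$ is the open unit ball. Random solutions. Write the system as: $y\in C$, $\dot y\in F_\varepsilon(y)$; $y\in D$, $y^+\in G(y,v)$, $v\sim\mu$, with $y=(x,z)$. The random input is an i.i.d. sequence $\mathbf v_k$, $k\ge1$, on a probability space $(\Omega,\mathcal F,\mathbb P)$ with distribution $\mu$. A hybrid time domain is a subset of $\mathbb R_{\ge0}\times\mathbb Z_{\ge0}$ that is a (finite or infinite) union of consecutive intervals $[t_j,t_{j+1}]\times\{j\}$, $0=t_0\le t_1\le\dots$, the last one (if any) possibly of the form $[t_j,\bar t)\times\{j\}$ with $\bar t\le\infty$; a hybrid arc is a function $\psi$ on a hybrid time domain $\mathrm{dom}(\psi)$ with $t\mapsto\psi(t,j)$ locally absolutely continuous for each $j$. Let $\mathcal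 F_0$ be trivial and $\mathcal F_\ell=\sigma(\mathbf v_1,\dots,\mathbf v_\ell)$. A stochastic hybrid arc is a map $\omega\mapsto\mathbf y_\omega$ to hybrid arcs such that $\omega\mapsto\mathrm{graph}(\mathbf y_\omega)=\{(t,j,s):(t,j)\in\mathrm{dom}(\mathbf y_\omega),s=\mathbf y_\omega(t,j)\}$ is $\mathcal F$-measurable with closed values; it is adapted if the restriction of this graph to $j\in\{0,\dots,\ell\}$ is $\mathcal F_\ell$-measurable in $\omega$ for each $\ell$. (A set-valued map $\Phi$ on $\Omega$ is $\mathcal F$-measurable if $\{\omega:\Phi(\omega)\cap O\ne\emptyset\}\in\mathcal F$ for every open $O$.) A random solution from $y_0$ is an adapted stochastic hybrid arc with $\mathbf y_\omega(0,0)=y_0$ such that: if $(t_1,j),(t_2,j)\in\mathrm{dom}(\mathbf y_\omega)$, $t_1<t_2$, then for almost all $t\in[t_1,t_2]$, $\mathbf y_\omega(t,j)\in C$ and $\dot{\mathbf y}_\omega(t,j)\in F_\varepsilon(\mathbf y_\omega(t,j))$; and if $(t,j),(t,j+1)\in\mathrm{dom}(\mathbf y_\omega)$, then $\mathbf y_\omega(t,j)\in D$ and $\mathbf y_\omega(t,j+1)\in G(\mathbf y_\omega(t,j),\mathbf v_{j+1}(\omega))$. It is maximal if it cannot be extended to a random solution whose sample paths are strictly longer with positive probability. UGASp of a compact set $\tilde{\mathcal A}$ means that all of the following hold, with $\varpi(y):=|y|_{\tilde{\mathcal A}}$ for $y\in C\cup D$. (C1) For each $\epsilon>0,\rho>0$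 there is $\delta>0$ such that every maximal random solution with $\varpi(\mathbf y_\omega(0,0))\le\delta$ satisfies $\mathbb P(\mathbf y_\omega(t,j)\in\tilde{\mathcal A}+\epsilon\mathbb B^\circ\ \forall(t,j)\in\mathrm{dom}(\mathbf y_\omega))\ge1-\rho$. (C2) For each $\delta>0,\rho>0$ there is $\epsilon>0$ such that the same inequality holds for every maximal random solution with $\varpi(\mathbf y_\omega(0,0))\le\delta$. (C3) For each $\epsilon,\rho,R>0$ there is $\bar T\ge0$ such that every random solution with $\varpi(\mathbf y_\omega(0,0))\le R$ satisfies $\mathbb P(\mathbf y_\omega(t,j)\in\tilde{\mathcal A}+\epsilon\mathbb B^\circ\ \forall (t,j)\in\mathrm{dom}(\mathbf y_\omega)\text{ with }t+j\ge\bar T)\ge1-\rho$. *)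

(* Defs.v *)
From HB Require Import structures.
From mathcomp Require Import all_boot all_order all_algebra.
From mathcomp Require Import finmap.
From mathcomp Require Import all_classical all_reals all_analysis.
Set Implicit Arguments.
Unset Strict Implicit.
Unset Printing Implicit Defensive.
Import Order.TTheory GRing.Theory Num.Theory.
Import numFieldNormedType.Exports.
Local Open Scope classical_set_scope.
Local Open Scope ring_scope.

Section Euclidean.
Context {R : realType} {m : nat}.
Implicit Types (x y : 'cV[R]_m) (S : set 'cV[R]_m).

(* The norm of MathComp-Analysis on matrices is the max norm. *)
Definition enorm x : R := Num.sqrt (\sum_(i < m) x i 0 ^+ 2).

Definition edist y S : R := inf [set enorm (y - s) | s in S].

(* S + e B, with B the open Euclidean unit ball *)
Definition inflate S (e : R) : set 'cV[R]_m :=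
  [set s + e *: b | s in S & b in [set b | enorm b < 1]].

End Euclidean.

Section Definiteness.
Context {R : realType} {m : nat}.

Definition posdefmx (M : 'M[R]_m) : Prop :=
  M^T = M /\ forall x : 'cV[R]_m, x != 0 -> 0 < (x^T *m M *m x) 0 0.

Definition negdefmx (M : 'M[R]_m) : Prop :=
  M^T = M /\ forall x : 'cV[R]_m, x != 0 -> (x^T *m M *m x) 0 0 < 0.

End Definiteness.

Section HybridArcs.
Context {R : realType}.

(* The three cases: infinitely many intervals; finitely many, all compact;
   finitely many, the last one half-open and possibly unbounded. *)
Definition hybrid_time_domain (E : set (R * nat)) : Prop :=
  exists t : nat -> R,
    [/\ t 0%N = 0,
        forall j, t j <= t j.+1 &
        [\/ E = \bigcup_j (`[t j, t j.+1] `*` [set j]),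
            exists J, E = \bigcup_(j in `I_J.+1) (`[t j, t j.+1] `*` [set j]) |
            exists J (tbar : \bar R), ((t J)%:E < tbar)%E /\
              E = \bigcup_(j in `I_J) (`[t j, t j.+1] `*` [set j])
                  `|` [set s | t J <= s /\ (s%:E < tbar)%E] `*` [set J]]].

Definition abs_continuous {m} (f : R -> 'cV[R]_m) (a b : R) : Prop :=
  forall e : R, 0 < e -> exists2 d : R, 0 < d &
    forall (k : nat) (u v : nat -> R),
      (forall i, (i < k)%N -> a <= u i /\ u i <= v i /\ v i <= b) ->
      trivIset `I_k (fun i => `]u i, v i[%classic) ->
      \sum_(i < k) (v i - u i) < d ->
      \sum_(i < k) enorm (f (v i) - f (u i)) < e.

Definition locally_abs_continuous {m} (f : R -> 'cV[R]_m) (I : set R) : Prop :=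
  forall a b, a <= b -> `[a, b] `<=` I -> abs_continuous f a b.

(* [arc_val] is total; its values outside [arc_dom] are irrelevant. *)
Record hybrid_arc (m : nat) := HybridArc {
  arc_dom : set (R * nat) ;
  arc_val : R -> nat -> 'cV[R]_m ;
  arc_domP : hybrid_time_domain arc_dom ;
  arc_valP : forall j, locally_abs_continuous (arc_val ^~ j)
                         [set t | arc_dom (t, j)] }.

Definition graph m (a : hybrid_arc m) : set (R * nat * 'cV[R]_m) :=
  [set p | arc_dom a p.1 /\ p.2 = arc_val a p.1.1 p.1.2].

Definition graph_upto m (l : nat) (a : hybrid_arc m) :
    set (R * nat * 'cV[R]_m) :=
  graph a `&` [set p | (p.1.2 <= l)%N].

End HybridArcs.
Arguments hybrid_arc R m : clear implicits.

(* Measurability, with respect to a sigma-algebra S on Omega, of a set-valued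
   map Omega => X. *)
Definition set_valued_measurable {Omega : Type} {X : topologicalType}
    (S : set (set Omega)) (Phi : Omega -> set X) : Prop :=
  forall O : set X, open O -> S [set w | Phi w `&` O !=set0].

Section RandomInput.
Context d (Omega : measurableType d) (R : realType) (P : probability Omega R).
Context dV (V : measurableType dV).
Implicit Types (mu : probability V R) (v : nat -> {mfun Omega >-> V}).

(* Indexing from 0: [v k] is the (k+1)-st input, consumed by the jump from
   (t, k) to (t, k+1). *)
Definition iid_inputs mu v : Prop :=
  (forall k A, measurable A -> distribution P (v k) A = mu A) /\
  (forall (J : {fset nat}) (A : nat -> set V),
     (forall i, measurable (A i)) ->
     P (\bigcap_(i in [set` J]) (v i @^-1` A i)) =
     (\prod_(i <- J) P (v i @^-1` A i))%E).

(* Generated by the first l inputs; trivial for l = 0. *)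
Definition input_filtration v (l : nat) : set (set Omega) :=
  <<s \bigcup_(k in `I_l) preimage_set_system setT (v k) measurable >>.

End RandomInput.

(* y \in C, y' \in F(y);  y \in D, y^+ \in G(y, v), v ~ mu *)
Record shs (R : realType) (m : nat) dV (V : measurableType dV) := Shs {
  flow_set : set 'cV[R]_m ;
  flow_map : 'cV[R]_m -> set 'cV[R]_m ;
  jump_set : set 'cV[R]_m ;
  jump_map : 'cV[R]_m -> V -> set 'cV[R]_m ;
  input_law : probability V R }.

Section RandomSolutions.
Context {R : realType} {m : nat} {dV} {V : measurableType dV}.
Context (H : shs R m V).

Section FixedInput.
Context {d} {Omega : measurableType d} (P : probability Omega R).
Context (v : nat -> {mfun Omega >-> V}).
Implicit Types A : set 'cV[R]_m.
Local Notation arcs := (Omega -> hybrid_arc R m).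

Definition stochastic_hybrid_arc (y : arcs) : Prop :=
  (forall w, closed (graph (y w))) /\
  set_valued_measurable measurable (fun w => graph (y w)).

Definition adapted (y : arcs) : Prop :=
  forall l, set_valued_measurable (input_filtration v l)
              (fun w => graph_upto l (y w)).

Definition flow_condition (y : arcs) : Prop :=
  forall w t1 t2 j, arc_dom (y w) (t1, j) -> arc_dom (y w) (t2, j) -> t1 < t2 ->
    {ae lebesgue_measure, forall t : R, t \in `[t1, t2] ->
       flow_set H (arc_val (y w) t j) /\
       exists2 y', is_derive t 1 (arc_val (y w) ^~ j) y' &
                   flow_map H (arc_val (y w) t j) y'}.

Definition jump_condition (y : arcs) : Prop :=
  forall w t j, arc_dom (y w) (t, j) -> arc_dom (y w) (t, j.+1) ->
    jump_set H (arc_val (y w) t j) /\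
    jump_map H (arc_val (y w) t j) (v j w) (arc_val (y w) t j.+1).

Definition random_solution (y0 : 'cV[R]_m) (y : arcs) : Prop :=
  [/\ stochastic_hybrid_arc y /\ adapted y,
      forall w, arc_val (y w) 0 0%N = y0,
      flow_condition y &
      jump_condition y].

Definition maximal_random_solution (y0 : 'cV[R]_m) (y : arcs) : Prop :=
  random_solution y0 y /\
  ~ exists y' : arcs,
      [/\ random_solution y0 y',
          forall w, graph (y w) `<=` graph (y' w) &
          (0 < P [set w | arc_dom (y w) `<` arc_dom (y' w)])%E].

Definition stays_near A (e rho Tbar : R) (y : arcs) : Prop :=
  ((1 - rho)%:E <=
   P [set w | forall t j, arc_dom (y w) (t, j) -> (Tbar <= t + j%:R)%R ->
                inflate A e (arc_val (y w) t j)])%E.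

Definition always_near A (e rho : R) (y : arcs) : Prop :=
  ((1 - rho)%:E <=
   P [set w | forall t j, arc_dom (y w) (t, j) ->
                inflate A e (arc_val (y w) t j)])%E.

(* y0 lies in the domain of y |-> |y|_A and this distance is at most r. *)
Definition initial_within A (r : R) (y0 : 'cV[R]_m) : Prop :=
  (flow_set H `|` jump_set H) y0 /\ edist y0 A <= r.

Definition ugasp_stability A : Prop :=
  forall e rho : R, 0 < e -> 0 < rho -> exists2 delta : R, 0 < delta &
    forall y0 (y : arcs), initial_within A delta y0 -> maximal_random_solution y0 y ->
      always_near A e rho y.

Definition ugasp_boundedness A : Prop :=
  forall delta rho : R, 0 < delta -> 0 < rho -> exists2 e : R, 0 < e &
    forall y0 (y : arcs), initial_within A delta y0 -> maximal_random_solution y0 y ->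
      always_near A e rho y.

Definition ugasp_attractivity A : Prop :=
  forall e rho r : R, 0 < e -> 0 < rho -> 0 < r -> exists2 Tbar : R, 0 <= Tbar &
    forall y0 (y : arcs), initial_within A r y0 -> random_solution y0 y ->
      stays_near A e rho Tbar y.

End FixedInput.

Definition UGASp (A : set 'cV[R]_m) : Prop :=
  forall d (Omega : measurableType d) (P : probability Omega R)
         (v : nat -> {mfun Omega >-> V}),
    iid_inputs P (input_law H) v ->
    [/\ ugasp_stability P v A, ugasp_boundedness P v A &
        ugasp_attractivity P v A].

End RandomSolutions.

(* sum_q lambda_q delta_q, with the ordinal q : 'I_N standing for the mode
   q + 1 of {1, ..., N} *)
Section ModeLaw.
Context {R : realType} {N : nat} (lambda : 'I_N -> R).
Hypothesis lambda_ge0 : forall q, 0 <= lambda q.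
Hypothesis lambda_sum1 : \sum_(q < N) lambda q = 1.

Definition mode_law of (forall q, 0 <= lambda q)
    & \sum_(q < N) lambda q = 1 : set (measurableTypeR R) -> \bar R :=
  fun A => (\sum_(q < N) (lambda q)%:E
                          * \d_(q.+1%:R : measurableTypeR R) A)%E.

Local Notation law := (mode_law lambda_ge0 lambda_sum1).

Let law0 : law set0 = 0%E.
Proof. by rewrite /mode_law big1// => q _; rewrite measure0 mule0. Qed.

Let law_ge0 A : (0 <= law A)%E.
Proof. by apply: sume_ge0 => q _; rewrite mule_ge0// lee_fin. Qed.

Let law_sigma_additive : semi_sigma_additive law.
Proof.
have E : law = msum (fun k => if insub k is Some q
    then mscale (NngNum (lambda_ge0 q)) \d_(k.+1%:R : measurableTypeR R)
    else mzero) N.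
  apply/funext => A; rewrite /mode_law /msum; apply: eq_bigr => q _.
  by rewrite valK.
by rewrite E; exact: measure_semi_sigma_additive.
Qed.

HB.instance Definition _ := isMeasure.Build _ _ _ law
  law0 law_ge0 law_sigma_additive.

Let law_setT : law setT = 1%E.
Proof.
rewrite /mode_law; under eq_bigr do rewrite diracT mule1.
by rewrite sumEFin lambda_sum1.
Qed.

HB.instance Definition _ := @Measure_isProbability.Build _ _ R law law_setT.

End ModeLaw.

Section SwitchedSystem.
Context {R : realType} {N n n2 : nat}.

(* y = (xi, q, tau, z); the mode q is stored as the real number q. *)
Local Notation state := 'cV[R]_(n + (1 + (1 + n2))).
Local Notation inputs := (measurableTypeR R * measurableTypeR R)%type.

Definition st_xi (y : state) : 'cV[R]_n := usubmx y.
Definition st_q (y : state) : R := usubmx (dsubmx y) 0 0.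
Definition st_tau (y : state) : R := usubmx (dsubmx (dsubmx y)) 0 0.
Definition st_z (y : state) : 'cV[R]_n2 := dsubmx (dsubmx (dsubmx y)).

(* q is the number of the mode indexed by the ordinal i *)
Definition is_mode (q : R) (i : 'I_N) : Prop := q = i.+1%:R.

Context (T eta eps : R) (A : 'I_N -> 'M[R]_n) (B : 'I_N -> 'M[R]_(n, n2))
        (H : 'M[R]_(n2, n)) (L : 'M[R]_n2).

Definition sw_flow_set : set state :=
  [set y | (exists i, is_mode (st_q y) i) /\ 0 <= st_tau y <= T].

Definition sw_flow_map (y : state) : set state :=
  [set y' | exists2 i, is_mode (st_q y) i &
     [/\ st_xi y' = A i *m st_xi y + B i *m st_z y,
         st_q y' = 0,
         - eta <= st_tau y' <= 0 &
         eps *: st_z y' = H *m st_xi y + L *m st_z y]].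

Definition sw_jump_set : set state :=
  [set y | (exists i, is_mode (st_q y) i) /\ st_tau y = 0].

Definition sw_jump_map (y : state) (v : inputs) : set state :=
  [set y' | [/\ st_xi y' = st_xi y, st_q y' = v.1,
                st_tau y' = v.2 & st_z y' = st_z y]].

Context (lambda : 'I_N -> R) (lambda_ge0 : forall q, 0 <= lambda q)
        (lambda_sum1 : \sum_(q < N) lambda q = 1) (T_gt0 : 0 < T).

Definition sw_input_law : probability inputs R :=
  (mode_law lambda_ge0 lambda_sum1 \x uniform_prob T_gt0)%E.

Definition switched_shs : shs R (n + (1 + (1 + n2))) inputs :=
  {| flow_set := sw_flow_set ;
     flow_map := sw_flow_map ;
     jump_set := sw_jump_set ;
     jump_map := sw_jump_map ;
     input_law := sw_input_law |}.

Definition sw_target : set state :=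
  [set y | [/\ st_xi y = 0, exists i, is_mode (st_q y) i,
               0 <= st_tau y <= T & st_z y = 0]].

End SwitchedSystem.

(* Main.v *)
Require Import Defs.
From HB Require Import structures.
From mathcomp Require Import all_boot all_order all_algebra.
From mathcomp Require Import finmap.
From mathcomp Require Import all_classical all_reals all_analysis.
From mathcomp Require Import measurable_realfun.
From mathcomp Require Import ring lra.
Set Implicit Arguments.
Unset Strict Implicit.
Unset Printing Implicit Defensive.
Import Order.TTheory GRing.Theory Num.Theory.
Import numFieldNormedType.Exports.
Local Open Scope classical_set_scope.
Local Open Scope ring_scope.

(** A single Lyapunov function proves all three properties at once.  Let
    w = z + L^-1 H xi be the boundary-layer variable and

      V (xi, q, tau, z) = (xi^T P_q xi + w^T P_z w) / (1 + sigma tau / T).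

    Along flows the denominator shrinks at a relative rate of at most
    sigma eta / T, which the first matrix inequality compensates for xi; the
    cross terms between xi and w are absorbed by the decay of w, of order
    1 / eps, once eps is small ([flow_rate]).  At a jump tau is 0 beforehand and
    uniform afterwards, and the mean of 1 / (1 + sigma u) over u in [0, 1] is
    kappa = log (1 + sigma) / sigma < 1.  The second inequality says that
    kappa P is below every P_q, so V decreases on average, with a margin
    ([jump_rate]); the timer factor makes the w part contract too, although a
    jump leaves xi and z unchanged.  Hence there is a > 0 such that
    exp (a (t + j)) V is nonincreasing along flows and nonincreasing in mean at
    jumps.

    By the maximal inequality for nonnegative supermartingales ([ville]),

      P (exp (a (t + j)) V >= K at some (t, j)) <= V (y0) / K,

    and V is comparable to |xi|^2 + |z|^2 ([lyap_bounds]).  Stability and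
    boundedness are the cases without discount, attractivity uses the factor
    exp (a Tbar): [excursion_prob] is the common estimate.

    Two points need care.  Solutions are only absolutely continuous and satisfy
    the flow condition almost everywhere, so decay along flows rests on
    [ac_nonincreasing].  And solutions are adversarial: when and whether to jump
    may be chosen randomly.  Adaptedness makes the graph up to level j
    independent of the input used by the jump out of that level, but the jump
    itself may depend on that input.  Therefore the supermartingale is not built
    from the solution after the jump, but from the values that a jump from the
    right end of level j would give in each mode ([endpoint_value],
    [jump_process]); the solution follows this process as long as it
    jumps ([discounted_lyap_start]).  Finally, the events in the definition of
    stability are measurable because a closed random set that hits open sets
    measurably also hits closed sets measurably ([measurable_closed_hit]). *)
(** * Absolutely continuous functions *)

Section AbsolutelyContinuous.
Context {R : realType}.
Implicit Types (f g F : R -> R) (a b : R).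

(** The real-valued case, with absolute values in place of Euclidean norms. *)
Definition ac f a b : Prop :=
  forall e : R, 0 < e -> exists2 d : R, 0 < d &
    forall (k : nat) (u v : nat -> R),
      (forall i, (i < k)%N -> a <= u i /\ u i <= v i /\ v i <= b) ->
      trivIset `I_k (fun i => `]u i, v i[%classic) ->
      \sum_(i < k) (v i - u i) < d ->
      \sum_(i < k) `|f (v i) - f (u i)| < e.

(** The common source of the closure properties below: a bound on increments
    transfers absolute continuity to sums, products and Lipschitz images. *)
Lemma ac_dominated F f g a b (K : R) :
  ac f a b -> ac g a b ->
  (forall u v, a <= u -> u <= v -> v <= b ->
     `|F v - F u| <= K * (`|f v - f u| + `|g v - g u|)) ->
  ac F a b.
Proof.
move=> acf acg FK e e0.
have K1 : 0 < `|K| + 1 by rewrite ltr_wpDl.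
have e1 : 0 < e / (`|K| + 1) / 2 by rewrite !divr_gt0.
have [d1 d10 H1] := acf _ e1; have [d2 d20 H2] := acg _ e1.
exists (Num.min d1 d2); first by rewrite lt_min d10 d20.
move=> k u v uv tr; rewrite lt_min => /andP[/(H1 _ _ _ uv tr) h1 /(H2 _ _ _ uv tr) h2].
apply: (@le_lt_trans _ _ (\sum_(i < k) (`|K| + 1) *
    (`|f (v i) - f (u i)| + `|g (v i) - g (u i)|))).
  apply: ler_sum => i _; have [ai [ui vi]] := uv i (ltn_ord i).
  apply: (le_trans (FK _ _ ai ui vi)); apply: ler_wpM2r; first by rewrite addr_ge0.
  by rewrite (le_trans (ler_norm _))// lerDl.
rewrite -mulr_sumr big_split/= mulrC -ltr_pdivlMr//.
by rewrite (splitr (e / _)) ltrD.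
Qed.

Lemma ac_cst (c : R) a b : ac (fun=> c) a b.
Proof.
move=> e e0; exists 1 => // k u v _ _ _.
by rewrite big1// => i _; rewrite subrr normr0.
Qed.

Lemma ac_add f g a b : ac f a b -> ac g a b -> ac (fun t => f t + g t) a b.
Proof.
move=> acf acg; apply: (@ac_dominated _ f g _ _ 1) => // u v _ _ _.
rewrite mul1r; have -> : f v + g v - (f u + g u) = (f v - f u) + (g v - g u) by lra.
exact: ler_normD.
Qed.

Lemma ac_lipschitz f (h : R -> R) (K : R) a b :
  (forall u v, a <= u -> u <= v -> v <= b ->
     `|h (f v) - h (f u)| <= K * `|f v - f u|) ->
  ac f a b -> ac (fun t => h (f t)) a b.
Proof.
move=> hK acf; apply: (@ac_dominated _ f (fun=> 0) _ _ K) => //; first exact: ac_cst.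
by move=> u v au uv vb; rewrite subrr normr0 addr0; exact: hK.
Qed.

Lemma ac_sum (I : finType) (f : I -> R -> R) a b :
  (forall i, ac (f i) a b) -> ac (fun t => \sum_i f i t) a b.
Proof.
move=> acf; have -> : (fun t => \sum_i f i t) = (\sum_i f i).
  by apply/funext => t; rewrite fct_sumE.
elim/big_rec: _ => [|i g _ acg]; [exact: ac_cst|exact: ac_add].
Qed.

Lemma ac_small_increments f a b (e : R) : ac f a b -> 0 < e ->
  exists2 d, 0 < d & forall u v, a <= u -> u <= v -> v <= b ->
    v - u < d -> `|f v - f u| < e.
Proof.
move=> acf e0; have [d d0 H] := acf e e0; exists d => // u v au uv vb vud.
have := H 1%N (fun=> u) (fun=> v); rewrite !big_ord1; apply => //.
by apply/trivIsetP => -[|i] [|j].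
Qed.


Lemma ac_bounded f a b : ac f a b -> exists M, forall t, a <= t <= b -> `|f t| <= M.
Proof.
move=> acf; have [d d0 H] := ac_small_increments acf ltr01.
(* Walk from [a] to [t] in steps of length d / 2: each costs at most 1. *)
have step n t : a <= t <= b -> t - a <= n%:R * (d / 2) -> `|f t| <= `|f a| + n%:R.
  elim: n t => [|n IH] t /andP[ta tb].
    by rewrite mul0r subr_le0 addr0 => ta'; have -> : t = a by apply/le_anti/andP.
  rewrite -natr1 mulrDl mul1r => tn; pose s := Num.max a (t - d / 2).
  have as_ : a <= s by rewrite /s le_max lexx.
  have st : s <= t by rewrite /s ge_max ta/=; lra.
  have ts : t - s < d.
    have : t - d / 2 <= s by rewrite /s le_max lexx orbT.
    by lra.
  have sn : s - a <= n%:R * (d / 2).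
    have n0 : 0 <= n%:R * (d / 2) by rewrite mulr_ge0// ltW// divr_gt0.
    by rewrite /s lerBlDr ge_max; apply/andP; split; lra.
  have := IH s; rewrite as_ (le_trans st tb) => /(_ isT sn) fs.
  have := H s t as_ st tb ts => fts.
  have : `|f t| <= `|f s| + `|f t - f s|.
    by apply: le_trans (ler_normD _ _); rewrite addrC subrK.
  by lra.
exists (`|f a| + (Num.truncn ((b - a) / (d / 2))).+1%:R) => t tab; apply: step => //.
rewrite -ler_pdivrMr ?divr_gt0//; apply: le_trans (ltW (truncnS_gt _)).
by rewrite ler_pM2r ?invr_gt0 ?divr_gt0//; move/andP: tab => [_ ?]; lra.
Qed.

Lemma ac_mul f g a b : ac f a b -> ac g a b -> ac (fun t => f t * g t) a b.
Proof.
move=> acf acg; have [M fM] := ac_bounded acf; have [M' gM] := ac_bounded acg.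
apply: (@ac_dominated _ f g _ _ (`|M| + `|M'|)) => // u v au uv vb.
have -> : f v * g v - f u * g u = f v * (g v - g u) + g u * (f v - f u) by ring.
apply: (le_trans (ler_normD _ _)); rewrite !normrM.
have fv : `|f v| <= `|M| + `|M'|.
  rewrite (le_trans (fM v _)) ?(le_trans au uv)//.
  by rewrite (le_trans (ler_norm _))// lerDl.
have gu : `|g u| <= `|M| + `|M'|.
  rewrite (le_trans (gM u _)) ?au ?(le_trans uv vb)//.
  by rewrite (le_trans (ler_norm _))// lerDr.
by rewrite mulrDr addrC lerD// ler_wpM2r.
Qed.

Lemma ac_expR (c : R) a b : ac (fun t => expR (c * t)) a b.
Proof.
have acid : ac (fun t => t) a b.
  move=> e e0; exists e => // k u v uv _ H; apply: le_lt_trans H.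
  by apply: ler_sum => i _; have [_ [? _]] := uv i (ltn_ord i); rewrite ger0_norm// subr_ge0.
pose M := expR (`|c| * (`|a| + `|b|)).
apply: (@ac_lipschitz (fun t => t) (fun t => expR (c * t)) (M * `|c|) a b _ acid) => u v au uv vb.
have bd t : a <= t -> t <= b -> c * t <= `|c| * (`|a| + `|b|).
  move=> at_ tb; apply: (le_trans (ler_norm _)); rewrite normrM ler_wpM2l//.
  rewrite ler_norml; have := ler_norm b; have := ler_norm (- a).
  by rewrite normrN; have := normr_ge0 a; have := normr_ge0 b => *; apply/andP; split; lra.
(* The graph of the exponential lies above its tangents. *)
have conv (x y : R) : expR x - expR y <= expR x * (x - y).
  have := expR_ge1Dx (y - x); rewrite expRD expRN => h.
  have := expR_gt0 x => x0; have := ler_wpM2l (ltW x0) h.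
  by rewrite mulrCA mulfV ?gt_eqF// mulr1; lra.
have conv' (x y : R) : x <= `|c| * (`|a| + `|b|) -> expR x - expR y <= M * `|x - y|.
  move=> xb; have /le_trans := conv x y; apply; apply: (le_trans (ler_norm _)).
  by rewrite normrM (ger0_norm (expR_ge0 _)) ler_wpM2r// ler_expR.
have -> : M * `|c| * `|v - u| = M * `|c * v - c * u| by rewrite -mulrBr normrM mulrA.
apply/ler_normlP; split.
  by rewrite opprB distrC; apply: conv'; apply: bd => //; exact: le_trans vb.
by apply: conv'; apply: bd => //; exact: le_trans uv.
Qed.

(** An exceptional null set costs nothing: it is covered by an open set of
    small measure, on which [f] varies little.  Away from it [f] grows at a
    rate at most [e], and both kinds of steps are chained from [a] to [b] by
    taking the supremum of the points that a chain reaches. *)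
Lemma ac_nonincreasing f a b (N : set R) :
  a <= b -> ac f a b -> lebesgue_measure.-negligible N ->
  (forall x, a <= x <= b -> ~ N x -> forall e, 0 < e -> exists2 d, 0 < d &
     forall u v, a <= u -> u <= x -> x <= v -> v <= b -> v - u < d ->
       f v - f u <= e * (v - u)) ->
  f b <= f a.
Proof.
move=> ab acf [N' [mN' N'0 NN']] slope.
apply/ler_addgt0Pr => e e0.
pose e' := e / 2 / (b - a + 1).
have ba1 : 0 < b - a + 1 by lra.
have e'0 : 0 < e' by rewrite !divr_gt0.
have [d d0 acd] := acf (e / 2) (divr_gt0 e0 (ltr0Sn _ _)).
have [U [oU N'U Ud]] : exists U : set R, [/\ open U, N' `<=` U &
    (lebesgue_measure U < d%:E)%E].
  have N0 : lebesgue_measure N' = 0%E := N'0.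
  have [|U [oU N'U UN']] := lebesgue_regularity_outer mN' _ d0; first by rewrite /= N0.
  exists U; split => //.
  apply: le_lt_trans UN'; rewrite -[leRHS]adde0 -N0.
  have mU : measurable U by exact: measurable_realfun.open_measurable.
  apply: le_trans (measureU2 _ _ _) => //; last exact: measurableD.
  apply: le_measure; rewrite ?inE//; first by apply: measurableU => //; exact: measurableD.
  by move=> x Ux; have [|] := pselect (N' x); [right|left].
pose chain x := exists (k : nat) (u v : nat -> R),
  [/\ forall i, (i < k)%N -> [/\ a <= u i, u i <= v i, v i <= x &
                                `[u i, v i] `<=` U],
      trivIset `I_k (fun i => `]u i, v i[%classic) &
      f x - f a <= e' * (x - a) + \sum_(i < k) (f (v i) - f (u i))].
have chain_a : chain a.
  exists 0%N, (fun=> a), (fun=> a); split => //.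
  by rewrite big_ord0 !subrr mulr0 addr0.
have chain_le x y : a <= x -> x <= y -> chain x ->
    f y - f x <= e' * (y - x) -> chain y.
  move=> ax xy [k [u [v [uv tr fx]]]] fxy; exists k, u, v; split => //.
    by move=> i /uv[? ? ? ?]; split => //; apply: le_trans xy.
  by have := lerD fx fxy; rewrite mulrBr; lra.
have chain_U x y : a <= x -> x <= y -> chain x -> `[x, y] `<=` U -> chain y.
  move=> ax xy [k [u [v [uv tr fx]]]] xyU.
  pose ext (p : nat -> R) (q : R) i := if (i < k)%N then p i else q.
  exists k.+1, (ext u x), (ext v y); split.
  - move=> i _; rewrite /ext; case: ifPn => [/uv[? ? ? ?]|_]; last by split.
    by split => //; apply: le_trans xy.
  - apply/trivIsetP => i j /= ik jk ij; rewrite /ext.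
    case: ifPn => ik'; case: ifPn => jk'.
    + by move/trivIsetP : tr; apply.
    + apply/seteqP; split => // z /= []; rewrite !in_itv/= => /andP[_ zi] /andP[xz _].
      by have [_ _ vx _] := uv _ ik'; move: (lt_le_trans zi vx); rewrite ltNge (ltW xz).
    + apply/seteqP; split => // z /= []; rewrite !in_itv/= => /andP[xz _] /andP[_ zi].
      by have [_ _ vx _] := uv _ jk'; move: (lt_le_trans zi vx); rewrite ltNge (ltW xz).
    + have := ij; rewrite -leqNgt in ik'; rewrite -leqNgt in jk'.
      rewrite !ltnS in ik jk.
      have -> : i = k by apply/eqP; rewrite eqn_leq ik.
      have -> : j = k by apply/eqP; rewrite eqn_leq jk.
      by rewrite eqxx.
  - rewrite big_ord_recr/= {3 4}/ext ltnn.
    rewrite (eq_bigr (fun i : 'I_k => f (v i) - f (u i))); last first.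
      by move=> i _; rewrite /ext ltn_ord.
    have : 0 <= e' * (y - x) by rewrite mulr_ge0 ?subr_ge0// ltW.
    by rewrite !mulrBr in fx *; lra.
(* A chain reaching close to [s] from the left can be prolonged past [s]. *)
have prolong s : a <= s <= b -> exists2 r, 0 < r & forall x y,
    a <= x -> x <= s -> s <= y -> y <= b -> y - x < r -> chain x -> chain y.
  move=> sab; have [Ns|Ns] := pselect (N' s).
    have /nbhs_ballP[r /= r0 sr] : nbhs s U by apply: open_nbhs_nbhs; split=> //; exact: N'U.
    exists r => // x y ax xs sy yb yxr chx; apply: (chain_U x) => //; first exact: le_trans sy.
    move=> z /=; rewrite in_itv/= => /andP[xz zy]; apply: sr; rewrite /ball/= ltr_norml.
    by apply/andP; split; lra.
  have [r r0 sr] := slope s sab (fun h => Ns (NN' _ h)) e' e'0.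
  exists r => // x y ax xs sy yb yxr chx; apply: (chain_le x) => //; first exact: le_trans sy.
  exact: sr.
pose S := [set x | a <= x <= b /\ chain x].
have Sa : S a by split => //; rewrite lexx.
have hS : has_sup S by split; [exists a | exists b => x [/andP[]]].
have sab : a <= sup S <= b.
  by rewrite ub_le_sup//=; [apply: ge_sup; [exists a| move=> x [/andP[]]]| case: hS].
have [r r0 Hr] := prolong _ sab.
have [x [/andP[ax xb] chx] xs] := sup_adherent (divr_gt0 r0 (ltr0Sn _ 1)) hS.
have xs' : x <= sup S by apply: ub_le_sup => //; [case: hS | rewrite /S/= ax xb].
have chb : chain b.
  pose y := Num.min b (sup S + r / 4).
  have sy : sup S <= y by rewrite le_min (andP sab).2/=; lra.
  have yb : y <= b by rewrite ge_min lexx.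
  have chy : chain y.
    apply: (Hr x) => //.
    have : y <= sup S + r / 4 by rewrite ge_min lexx orbT.
    by lra.
  have ys : y <= sup S.
    apply: ub_le_sup; first by case: hS.
    by split => //; rewrite yb andbT (le_trans _ sy)//; case/andP: sab.
  move: ys; rewrite /y ge_min => /orP[bs|]; last by lra.
  by have -> : b = y by apply/le_anti; rewrite yb (le_trans bs sy).
have [k [u [v [uv tr fb]]]] := chb.
have len : \sum_(i < k) (v i - u i) < d.
  rewrite -lte_fin; apply: le_lt_trans Ud.
  have -> : (\sum_(i < k) (v i - u i))%:E =
      lebesgue_measure (\big[setU/set0]_(i < k) `]u i, v i[%classic).
    transitivity (\sum_(i < k) lebesgue_measure `]u i, v i[%classic)%E.
      rewrite -sumEFin; apply: eq_bigr => i _; rewrite lebesgue_measure_itv/= lte_fin.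
      have [_ ui _ _] := uv i (ltn_ord i); case: ltP => // vi.
      by have -> : v i = u i; [apply/le_anti/andP | rewrite subrr].
    symmetry; apply: (@measure_semi_additive_ord_I _ _ _ lebesgue_measure
      (fun i => `]u i, v i[%classic)) => //.
    by apply: bigsetU_measurable.
  apply: le_measure; rewrite ?inE.
  - by apply: bigsetU_measurable.
  - exact: measurable_realfun.open_measurable.
  - rewrite -(bigcup_mkord k (fun i => `]u i, v i[%classic)) => z [i /= ik zi]; have [_ _ _] := uv _ ik; apply.
    by move: zi; rewrite /= !in_itv/= => /andP[/ltW-> /ltW->].
have uv' i : (i < k)%N -> a <= u i /\ u i <= v i /\ v i <= b by move=> /uv[].
have := acd k u v uv' tr len => sm.
have : \sum_(i < k) (f (v i) - f (u i)) <= \sum_(i < k) `|f (v i) - f (u i)|.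
  by apply: ler_sum => i _; exact: ler_norm.
have : e' * (b - a) <= e / 2.
  by rewrite /e' mulrAC ler_pdivrMr// ler_wpM2l ?ltW ?divr_gt0//; lra.
by lra.
Qed.

End AbsolutelyContinuous.

Section MonotoneFromDerivative.
Context {R : realType}.

(** The derivative controls the increment over every short interval around
    [x], not only over those with [x] as an endpoint; this is the form in which
    the points of a chain are used. *)
Lemma slope_le_of_derive (f : R -> R) (x f' : R) : is_derive x 1 f f' -> f' <= 0 ->
  forall e, 0 < e -> exists2 d, 0 < d &
    forall u v, u <= x -> x <= v -> v - u < d -> f v - f u <= e * (v - u).
Proof.
move=> [dfx <-] f'0 e e0.
have : (h^-1 *: ((f \o shift x) (h *: 1) - f x)) @[h --> 0^'] --> 'D_1 f x by exact: dfx.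
move=> /cvgrPdist_lt/(_ _ e0)[/= d d0 H]; exists d => // u v ux xv uvd.
have quot h : h != 0 -> `|h| < d -> h^-1 * (f (h + x) - f x) < e.
  move=> h0 hd; have := H h; rewrite /= sub0r normrN => /(_ hd h0).
  rewrite ltr_norml => /andP[+ _].
  rewrite /= -[h *: 1]/(h * 1) mulr1 -[X in _ - X]/(h^-1 * (f (h + x) - f x)).
  by lra.
have right : f v - f x <= e * (v - x).
  have [->|xv'] := eqVneq x v; first by rewrite !subrr mulr0.
  have vx : 0 < v - x by rewrite subr_gt0 lt_neqAle xv' xv.
  have := quot (v - x); rewrite subrK gt_eqF// gtr0_norm// => /(_ isT).
  have -> : v - x < d by lra.
  by move=> /(_ isT); rewrite mulrC ltr_pdivrMr// => /ltW.
have left : f x - f u <= e * (x - u).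
  have [->|ux'] := eqVneq u x; first by rewrite !subrr mulr0.
  have xu : 0 < x - u by rewrite subr_gt0 lt_neqAle ux' ux.
  have := quot (u - x); rewrite subrK subr_eq0 ux' distrC gtr0_norm// => /(_ isT).
  have -> : x - u < d by lra.
  have -> : (u - x)^-1 * (f u - f x) = (x - u)^-1 * (f x - f u).
    by rewrite -[u - x]opprB -[f u - f x]opprB invrN mulrNN.
  by move=> /(_ isT); rewrite mulrC ltr_pdivrMr// => /ltW.
by lra.
Qed.

Lemma ac_derive_nonincreasing (f : R -> R) (a b : R) : a <= b -> ac f a b ->
  {ae lebesgue_measure, forall t : R, t \in `[a, b] ->
     exists2 f', is_derive t 1 f f' & f' <= 0} ->
  f b <= f a.
Proof.
move=> ab acf aef; apply: (ac_nonincreasing ab acf aef) => x xab nx e e0.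
have [f' df f'0] : exists2 f', is_derive x 1 f f' & f' <= 0.
  by apply: contrapT => h; apply: nx => /= /(_ _)/h; apply; rewrite in_itv.
have [d d0 H] := slope_le_of_derive df f'0 e0.
by exists d => // u v _ ux xv _; exact: H.
Qed.

(** Null sets have dense complements. *)
Lemma ae_itv_witness (P : R -> Prop) (a b u v : R) :
  {ae lebesgue_measure, forall t : R, t \in `[a, b] -> P t} ->
  a <= u -> u < v -> v <= b -> exists2 t, u <= t <= v & P t.
Proof.
move=> [N [mN N0 PN]] au uv vb; apply: contrapT => nP.
have uvN : `[u, v]%classic `<=` N.
  move=> t /=; rewrite in_itv/= => /andP[ut tv]; apply: PN => /= h.
  apply: nP; exists t; first by rewrite ut tv.
  by apply: h; rewrite in_itv/= (le_trans au ut) (le_trans tv vb).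
have : (lebesgue_measure (`[u, v]%classic : set R) <= lebesgue_measure N)%E.
  by apply: le_measure; rewrite ?inE.
have -> : lebesgue_measure N = 0%E := N0.
by rewrite lebesgue_measure_itv/= lte_fin uv -EFinD lee_fin; lra.
Qed.

End MonotoneFromDerivative.

(** * Quadratic forms *)

Section QuadraticForms.
Context {R : realType}.

Definition bform {m k} (M : 'M[R]_(m, k)) (x : 'cV[R]_m) (y : 'cV[R]_k) : R :=
  (x^T *m M *m y) 0 0.

Definition sqnorm {m} (x : 'cV[R]_m) : R := \sum_(i < m) x i 0 ^+ 2.

Lemma sqnorm_ge0 m (x : 'cV[R]_m) : 0 <= sqnorm x.
Proof. by apply: sumr_ge0 => i _; exact: sqr_ge0. Qed.

Lemma sqnormE m (x : 'cV[R]_m) : sqnorm x = (x^T *m x) 0 0.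
Proof. by rewrite mxE; apply: eq_bigr => i _; rewrite mxE expr2. Qed.

Lemma bformE m k (M : 'M[R]_(m, k)) x y :
  bform M x y = \sum_i \sum_j x i 0 * M i j * y j 0.
Proof.
rewrite /bform -mulmxA mxE; apply: eq_bigr => i _.
by rewrite mxE [(M *m y) _ _]mxE mulr_sumr; apply: eq_bigr => j _; rewrite mulrA.
Qed.

Lemma bformDl m k (M : 'M[R]_(m, k)) x x' y :
  bform M (x + x') y = bform M x y + bform M x' y.
Proof. by rewrite /bform linearD/= !mulmxDl mxE. Qed.

Lemma bformDr m k (M : 'M[R]_(m, k)) x y y' :
  bform M x (y + y') = bform M x y + bform M x y'.
Proof. by rewrite /bform mulmxDr mxE. Qed.

Lemma bformDm m k (M M' : 'M[R]_(m, k)) x y :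
  bform (M + M') x y = bform M x y + bform M' x y.
Proof. by rewrite /bform mulmxDr mulmxDl mxE. Qed.

Lemma bformZm m k c (M : 'M[R]_(m, k)) x y : bform (c *: M) x y = c * bform M x y.
Proof. by rewrite /bform -scalemxAr -scalemxAl mxE. Qed.

Lemma bformNm m k (M : 'M[R]_(m, k)) x y : bform (- M) x y = - bform M x y.
Proof. by rewrite -scaleN1r bformZm mulN1r. Qed.

Lemma bformZr m k c (M : 'M[R]_(m, k)) x y : bform M x (c *: y) = c * bform M x y.
Proof. by rewrite /bform -scalemxAr mxE. Qed.

Lemma bformZl m k c (M : 'M[R]_(m, k)) x y : bform M (c *: x) y = c * bform M x y.
Proof. by rewrite /bform linearZ/= -!scalemxAl mxE. Qed.

Lemma bform_mulr m k p (M : 'M[R]_(m, k)) (A : 'M[R]_(k, p)) x y :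
  bform M x (A *m y) = bform (M *m A) x y.
Proof. by rewrite /bform !mulmxA. Qed.

Lemma bform_tr m k (M : 'M[R]_(m, k)) x y : bform M^T y x = bform M x y.
Proof.
have -> : bform M x y = (x^T *m M *m y)^T 0 0 by rewrite mxE.
by rewrite !trmx_mul trmxK mulmxA.
Qed.

Lemma bform_sum m k (I : finType) (M : I -> 'M[R]_(m, k)) x y :
  bform (\sum_i M i) x y = \sum_i bform (M i) x y.
Proof.
rewrite (big_morph (fun M => bform M x y) (id1 := 0) (op1 := +%R))//.
  by move=> M1 M2; exact: bformDm.
by rewrite /bform mulmx0 mul0mx mxE.
Qed.

Lemma qform_bound m (M : 'M[R]_m) :
  exists2 K, 0 <= K & forall x, `|bform M x x| <= K * sqnorm x.
Proof.
exists (\sum_i \sum_j `|M i j|); first by apply: sumr_ge0 => i _; exact: sumr_ge0.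
move=> x; rewrite bformE mulr_suml; apply: (le_trans (ler_norm_sum _ _ _)).
apply: ler_sum => i _; rewrite mulr_suml; apply: (le_trans (ler_norm_sum _ _ _)).
apply: ler_sum => j _; rewrite mulrAC mulrC normrM ler_wpM2l// normrM.
have le_sq k : `|x k 0| ^+ 2 <= sqnorm x.
  rewrite real_normK ?num_real// /sqnorm (bigD1 k)//= lerDl.
  by apply: sumr_ge0 => l _; exact: sqr_ge0.
have := le_sq i; have := le_sq j; have := sqr_ge0 (`|x i 0| - `|x j 0|).
by rewrite sqrrB; lra.
Qed.

Lemma sqnorm_mul_bound m k (M : 'M[R]_(m, k)) :
  exists2 K, 0 <= K & forall x, sqnorm (M *m x) <= K * sqnorm x.
Proof.
have [K K0 H] := qform_bound (M^T *m M); exists K => // x.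
by apply: le_trans (H x); rewrite sqnormE /bform trmx_mul !mulmxA ler_norm.
Qed.

(** Young's inequality: the weight [d] moves the cost of a cross term onto
    whichever of the two variables can afford it. *)
Lemma bform_young m k (M : 'M[R]_(m, k)) (d : R) : 0 < d ->
  exists2 K, 0 <= K & forall x y, bform M x y <= d * sqnorm x + K * sqnorm y.
Proof.
move=> d0; have [K K0 H] := sqnorm_mul_bound M.
exists (K / (4 * d)); first by rewrite divr_ge0// mulr_ge0// ltW.
move=> x y; apply: (@le_trans _ _ (d * sqnorm x + sqnorm (M *m y) / (4 * d))).
  rewrite /bform -mulmxA mxE /sqnorm mulr_sumr mulr_suml -big_split/=.
  apply: ler_sum => i _; rewrite mxE; set s := (M *m y) i 0; set t := x i 0.
  have : 0 <= d * (t - s / (2 * d)) ^+ 2 by rewrite mulr_ge0 ?sqr_ge0// ltW.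
  suff -> : d * (t - s / (2 * d)) ^+ 2 = d * t ^+ 2 + s ^+ 2 / (4 * d) - t * s by lra.
  by field; rewrite gt_eqF.
by rewrite lerD2l mulrAC ler_wpM2r// invr_ge0 mulr_ge0// ltW.
Qed.

Lemma qform_sq_expand m (M : 'M[R]_m) x y (t : R) : M^T = M ->
  bform M (x - t *: y) (x - t *: y) =
  bform M x x - 2 * t * bform M x y + t ^+ 2 * bform M y y.
Proof.
move=> Ms; have bC : bform M y x = bform M x y by rewrite -{1}Ms bform_tr.
rewrite -scaleNr !(bformDl, bformDr, bformZl, bformZr) bC; ring.
Qed.

Lemma posdefmx_unit m (M : 'M[R]_m) : posdefmx M -> M \in unitmx.
Proof.
move=> [_ Mpos]; rewrite -row_free_unit -kermx_eq0.
apply/rowV0P => v /sub_kermxP vM0; apply: contrapT => /eqP v0.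
have := Mpos v^T; rewrite trmxK vM0 mul0mx mxE ltxx => h.
suff : false by [].
by apply: h; apply: contra v0 => /eqP vT; rewrite -[v]trmxK vT trmx0.
Qed.

Lemma posdefmx_ge0 m (M : 'M[R]_m) x : posdefmx M -> 0 <= bform M x x.
Proof.
move=> [_ Mpos]; have [->|x0] := eqVneq x 0; last exact/ltW/Mpos.
by rewrite /bform mulmx0 mxE.
Qed.

(** Expand the nonnegative value of the form at [x - t M^-1 x], whose cross term
    is the squared norm of [x], and take [t] small. *)
Lemma posdefmx_coercive m (M : 'M[R]_m) : posdefmx M ->
  exists2 c, 0 < c & forall x, c * sqnorm x <= bform M x x.
Proof.
move=> Mp; have Mu := posdefmx_unit Mp; have [Ms _] := Mp.
have [K K0 H] := qform_bound (invmx M)^T.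
have K1 : 0 < K + 1 by rewrite ltr_wpDl.
pose t := (K + 1)^-1; have t0 : 0 < t by rewrite invr_gt0.
exists t => // x; pose y := invmx M *m x.
have := posdefmx_ge0 (x - t *: y) Mp; rewrite qform_sq_expand//.
have -> : bform M x y = sqnorm x.
  by rewrite bform_mulr mulmxV// /bform mulmx1 -sqnormE.
have -> : bform M y y = bform (invmx M)^T x x.
  by rewrite {2}/y bform_mulr mulmxV// /bform /y trmx_mul !mulmx1.
have : bform (invmx M)^T x x <= K * sqnorm x by apply: le_trans (H x); exact: ler_norm.
move=> hK h; have : t ^+ 2 * bform (invmx M)^T x x <= t * sqnorm x.
  rewrite expr2 -mulrA ler_pM2l//; apply: (le_trans (ler_wpM2l (ltW t0) hK)).
  rewrite mulrA ler_piMl ?sqnorm_ge0// /t mulrC ler_pdivrMr// mul1r.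
  by lra.
by lra.
Qed.

Lemma negdefmx_coercive m (M : 'M[R]_m) : negdefmx M ->
  exists2 c, 0 < c & forall x, bform M x x <= - c * sqnorm x.
Proof.
move=> [Ms Mn].
have [|c c0 H] := @posdefmx_coercive m (- M).
  split; first by rewrite linearN/= Ms.
  by move=> x /Mn; rewrite -[X in 0 < X]/(bform (- M) x x) bformNm oppr_gt0.
by exists c => // x; have := H x; rewrite bformNm mulNr; lra.
Qed.

Lemma qform_upper m (M : 'M[R]_m) :
  exists2 K, 0 <= K & forall x, bform M x x <= K * sqnorm x.
Proof.
have [K K0 H] := qform_bound M; exists K => // x.
exact: le_trans (ler_norm _) (H x).
Qed.

(** On the kernel of [L] the Lyapunov expression vanishes, so definiteness
    leaves no room for a kernel. *)
Lemma hurwitz_unit m (L Pz : 'M[R]_m) : negdefmx (L^T *m Pz + Pz *m L) -> L \in unitmx.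
Proof.
move=> [_ neg]; rewrite -unitmx_tr -row_free_unit -kermx_eq0.
apply/rowV0P => v /sub_kermxP vL0; apply: contrapT => /eqP v0.
have Lv : L *m v^T = 0 by rewrite -[LHS]trmxK trmx_mul trmxK vL0 trmx0.
have := neg v^T; rewrite trmxK mulmxDr mulmxDl mulmxA vL0 !mul0mx add0r.
rewrite -!mulmxA Lv !mulmx0 mxE ltxx => h; suff : false by [].
by apply: h; apply: contra v0 => /eqP vT; rewrite -[v]trmxK vT trmx0.
Qed.

End QuadraticForms.

(** * Decay rates of the Lyapunov function *)

Section Rates.
Context {R : realType}.

Lemma small_uniform (I : finType) (P : I -> R -> Prop) :
  (forall i, exists2 a0, 0 < a0 & forall a, 0 < a <= a0 -> P i a) ->
  exists2 a0, 0 < a0 & forall a, 0 < a <= a0 -> forall i, P i a.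
Proof.
move=> H; pose f i := sval (cid2 (H i)).
have f0 i : 0 < f i by rewrite /f; case: cid2.
have fP i a : 0 < a <= f i -> P i a by rewrite /f; case: cid2 => /= x _ +; apply.
exists (\big[Num.min/1]_i f i); first by apply: lt_bigmin => // i _; exact: f0.
move=> a /andP[a0 af] i; apply: fP; rewrite a0 (le_trans af)//.
exact: bigmin_le_cond.
Qed.

(** Two time scales: the cross terms between [xi] and the boundary-layer
    variable [w] are split by Young's inequality, with a weight on [xi] that
    the slow decay absorbs; whatever is left on [w] is absorbed by the fast
    decay, which is of order 1 / [eps]. *)
Lemma flow_rate n n2 (A P : 'M[R]_n) (B : 'M[R]_(n, n2)) (L Pz : 'M[R]_n2)
    (G : 'M[R]_(n2, n)) (k : R) : 0 <= k ->
  P^T = P -> Pz^T = Pz ->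
  negdefmx (A^T *m P + P *m A + k *: P) -> negdefmx (L^T *m Pz + Pz *m L) ->
  exists2 a0, 0 < a0 & forall a, 0 < a <= a0 ->
  exists2 e0, 0 < e0 & forall eps, 0 < eps <= e0 -> forall xi w,
    2 * bform P xi (A *m xi + B *m w)
    + 2 * bform Pz w (eps^-1 *: (L *m w) + G *m (A *m xi + B *m w))
    + (a + k) * (bform P xi xi + bform Pz w w) <= 0.
Proof.
move=> k0 Ps Pzs /negdefmx_coercive[c1 c10 H1] /negdefmx_coercive[c2 c20 H2].
have [K1 K10 HK1] := qform_upper P; have [K2 K20 HK2] := qform_upper Pz.
have c18 : 0 < c1 / 8 by rewrite divr_gt0.
have [Ka Ka0 HKa] := bform_young (P *m B) c18.
have [Kb Kb0 HKb] := bform_young (Pz *m G *m A)^T c18.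
have [Kc Kc0 HKc] := qform_upper (Pz *m G *m B).
exists (c1 / 2 / (K1 + 1)); first by rewrite !divr_gt0// ltr_wpDl.
move=> a /andP[a0 aK].
have aK1 : a * K1 <= c1 / 2.
  have K11 : 0 < K1 + 1 by rewrite ltr_wpDl.
  move: aK; rewrite ler_pdivlMr//; rewrite mulrDr mulr1; lra.
pose M := 2 * Ka + 2 * Kb + 2 * Kc + (a + k) * K2.
have M0 : 0 <= M.
  by rewrite /M !addr_ge0 ?mulr_ge0 ?addr_ge0// ltW.
exists (c2 / (M + 1)); first by rewrite divr_gt0// ltr_wpDl.
move=> eps /andP[e0 eM] xi w.
have symP m (Q : 'M[R]_m) (A' : 'M[R]_m) x : Q^T = Q ->
    2 * bform Q x (A' *m x) = bform (A'^T *m Q + Q *m A') x x.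
  move=> Qs; rewrite bformDm bform_mulr -(bform_tr (A'^T *m Q)).
  by rewrite trmx_mul trmxK Qs; ring.
have s0 := sqnorm_ge0 xi; have r0 := sqnorm_ge0 w.
set s := sqnorm xi in s0; set r := sqnorm w in r0.
have e1 : 2 * bform P xi (A *m xi) + k * bform P xi xi <= - c1 * s.
  by rewrite symP// -bformZm -bformDm; exact: H1.
have e2 : 2 * bform Pz w (L *m w) <= - c2 * r by rewrite symP//; exact: H2.
have e3 : bform P xi (B *m w) <= c1 / 8 * s + Ka * r by rewrite bform_mulr; exact: HKa.
have e4 : bform Pz w (G *m (A *m xi)) <= c1 / 8 * s + Kb * r.
  by rewrite !bform_mulr -bform_tr; exact: HKb.
have e5 : bform Pz w (G *m (B *m w)) <= Kc * r by rewrite !bform_mulr; exact: HKc.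
have e6 : a * bform P xi xi <= c1 / 2 * s.
  apply: (le_trans (ler_wpM2l (ltW a0) (HK1 xi))).
  by rewrite mulrA ler_wpM2r.
have e7 : (a + k) * bform Pz w w <= (a + k) * K2 * r.
  by rewrite -mulrA ler_wpM2l// ?HK2// addr_ge0// ltW.
have e8 : eps^-1 * (2 * bform Pz w (L *m w)) <= - (M + 1) * r.
  apply: (@le_trans _ _ (eps^-1 * (- c2 * r))); first by rewrite ler_pM2l ?invr_gt0.
  rewrite !mulNr mulrN lerN2 mulrA ler_wpM2r//.
  by rewrite mulrC ler_pdivlMr// mulrC -ler_pdivlMr// ltr_wpDl.
rewrite !bformDr bformZr mulmxDr bformDr.
rewrite /M in e8; lra.
Qed.

(** Strictness of the inequality at jumps leaves room for the factor
    [expR a], so the Lyapunov function decays at jumps as well as in time. *)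
Lemma jump_rate n (Pbar P : 'M[R]_n) (kappa : R) : 0 <= kappa < 1 ->
  negdefmx (kappa *: Pbar - P) ->
  exists2 a0, 0 < a0 & forall a, 0 < a <= a0 ->
    expR a * kappa <= 1 /\
    forall xi, expR a * kappa * bform Pbar xi xi <= bform P xi xi.
Proof.
move=> /andP[k0 k1] /negdefmx_coercive[c c0 H].
have [K K0 HK] := qform_upper Pbar; have K1 : 0 < K + 1 by rewrite ltr_wpDl.
pose r := Num.min (c / (K + 1)) (1 - kappa).
have r0 : 0 < r by rewrite lt_min divr_gt0//= subr_gt0.
exists (ln (1 + r)); first by rewrite ln_gt0// ltrDl.
move=> a /andP[a0 ar].
have ea : expR a <= 1 + r.
  by rewrite -[1 + r]lnK ?posrE ?ler_expR// addr_gt0.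
have ea1 : 1 <= expR a by rewrite -expR0 ler_expR ltW.
have rk : r <= 1 - kappa by rewrite ge_min lexx orbT.
have rK : r * (K + 1) <= c by rewrite -ler_pdivlMr// ge_min lexx.
split; first by apply: (le_trans (ler_wpM2r k0 ea)); nra.
move=> xi; have := H xi; rewrite bformDm bformNm bformZm => h.
have := HK xi; have := sqnorm_ge0 xi => s0 hK.
have p1 : 0 <= (expR a - 1) * kappa by rewrite mulr_ge0// subr_ge0.
have p2 : (expR a - 1) * kappa <= r.
  apply: (@le_trans _ _ ((expR a - 1) * 1)); last by rewrite mulr1; lra.
  by rewrite ler_wpM2l ?subr_ge0// ltW.
have h1 := ler_wpM2l p1 hK.
have h2 : (expR a - 1) * kappa * (K * sqnorm xi) <= r * (K * sqnorm xi).
  by rewrite ler_wpM2r// mulr_ge0.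
have h3 : r * (K + 1) * sqnorm xi <= c * sqnorm xi by rewrite ler_wpM2r.
have h4 : 0 <= r * sqnorm xi by rewrite mulr_ge0// ltW.
have -> : expR a * kappa * bform Pbar xi xi =
  kappa * bform Pbar xi xi + (expR a - 1) * kappa * bform Pbar xi xi by ring.
by lra.
Qed.

(** This number is the mean of 1 / (1 + s u) for [u] uniform on [0, 1].  Since it
    is below 1, a jump contracts on average even the part of the Lyapunov
    function that belongs to the fast state, which no jump resets. *)
Lemma ln1D_div_lt1 (s : R) : 0 < s -> 0 <= s^-1 * ln (1 + s) < 1.
Proof.
move=> s0; rewrite mulr_ge0 ?invr_ge0 ?ln_ge0 ?lerDl ?ltW//=.
rewrite mulrC ltr_pdivrMr// mul1r -ltr_expR lnK ?posrE ?addr_gt0//.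
by apply: expR_gt1Dx; rewrite gt_eqF.
Qed.

End Rates.

(** * Decay of the Lyapunov function along flows *)

Section Trajectories.
Context {R : realType}.

Lemma coord_le_enorm m (x : 'cV[R]_m) i : `|x i 0| <= enorm x.
Proof.
rewrite -sqrtr_sqr ler_wsqrtr// (bigD1 i)//= lerDl.
by apply: sumr_ge0 => j _; exact: sqr_ge0.
Qed.

Lemma ae_imply (P Q : R -> Prop) : {ae lebesgue_measure, forall t : R, P t} ->
  (forall t, P t -> Q t) -> {ae lebesgue_measure, forall t : R, Q t}.
Proof.
by move=> [A [mA A0 PA]] PQ; exists A; split => // t /= Qt; apply: PA => /PQ.
Qed.

Definition coord_ac m (x : R -> 'cV[R]_m) (a b : R) :=
  forall i, ac (fun t => x t i 0) a b.

Definition coord_derive m (x : R -> 'cV[R]_m) (t : R) (x' : 'cV[R]_m) :=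
  forall i, is_derive t 1 (fun s => x s i 0) (x' i 0).

Lemma abs_continuous_coord m (x : R -> 'cV[R]_m) a b :
  abs_continuous x a b -> coord_ac x a b.
Proof.
move=> acx i e /acx[d d0 H]; exists d => // k u v uv tr /(H _ _ _ uv tr).
apply: le_lt_trans; apply: ler_sum => j _.
by apply: le_trans (coord_le_enorm _ i); rewrite !mxE.
Qed.

Lemma is_derive_coord m (x : R -> 'cV[R]_m) (t : R) x' :
  is_derive t 1 x x' -> coord_derive x t x'.
Proof.
move=> [dx <-] i; have := dx => /derivable_mxP/(_ i 0) dxi.
by rewrite derive_mx// mxE; exact: derivableP.
Qed.

Lemma is_derive_bigsum (k : nat) (f : 'I_k -> R -> R) (t : R) (df : 'I_k -> R) :
  (forall i, is_derive t 1 (f i) (df i)) ->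
  is_derive t 1 (fun s => \sum_i f i s) (\sum_i df i).
Proof.
move=> H; have -> : (fun s => \sum_i f i s) = \sum_i f i.
  by apply/funext => s; rewrite fct_sumE.
exact: is_derive_sum.
Qed.

Lemma ac_bform m k (M : 'M[R]_(m, k)) x y a b : coord_ac x a b -> coord_ac y a b ->
  ac (fun t => bform M (x t) (y t)) a b.
Proof.
move=> acx acy; rewrite (_ : (fun t => _) =
    (fun t => \sum_i \sum_j x t i 0 * M i j * y t j 0)); last first.
  by apply/funext => t; rewrite bformE.
apply: ac_sum => i; apply: ac_sum => j; apply: ac_mul => //.
by apply: ac_mul => //; exact: ac_cst.
Qed.

Lemma derive_bform m k (M : 'M[R]_(m, k)) x y (t : R) x' y' :
  coord_derive x t x' -> coord_derive y t y' ->
  is_derive t 1 (fun s => bform M (x s) (y s)) (bform M x' (y t) + bform M (x t) y').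
Proof.
move=> dx dy; rewrite (_ : (fun s => _) =
    (fun s => \sum_i \sum_j x s i 0 * M i j * y s j 0)); last first.
  by apply/funext => s; rewrite bformE.
have -> : bform M x' (y t) + bform M (x t) y' = \sum_i \sum_j
    (x' i 0 * M i j * y t j 0 + x t i 0 * M i j * y' j 0).
  rewrite !bformE -big_split/=; apply: eq_bigr => i _.
  by rewrite -big_split.
apply: is_derive_bigsum => i; apply: is_derive_bigsum => j.
have d1 := dx i; have d2 := dy j.
have d3 : is_derive t 1 (fun s => x s i 0 * M i j) (x' i 0 * M i j).
  have := is_deriveM d1 (is_derive_cst (M i j) t 1) => h.
  by apply: is_derive_eq h _; rewrite scaler0 add0r /GRing.scale/= mulrC.
have := is_deriveM d3 d2 => h; apply: is_derive_eq h _.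
by rewrite /GRing.scale/=; ring.
Qed.

Lemma coord_ac_add m (x y : R -> 'cV[R]_m) a b : coord_ac x a b -> coord_ac y a b ->
  coord_ac (fun t => x t + y t) a b.
Proof.
move=> acx acy i; rewrite (_ : (fun t => _) = (fun t => x t i 0 + y t i 0)).
  exact: ac_add.
by apply/funext => t; rewrite mxE.
Qed.

Lemma coord_derive_add m (x y : R -> 'cV[R]_m) (t : R) x' y' :
  coord_derive x t x' -> coord_derive y t y' ->
  coord_derive (fun s => x s + y s) t (x' + y').
Proof.
move=> dx dy i; rewrite mxE (_ : (fun s => _) = (fun s => x s i 0 + y s i 0)).
  exact: (is_deriveD (dx i) (dy i)).
by apply/funext => s; rewrite mxE.
Qed.

Lemma coord_ac_mul m k (M : 'M[R]_(m, k)) x a b : coord_ac x a b ->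
  coord_ac (fun t => M *m x t) a b.
Proof.
move=> acx i; rewrite (_ : (fun t => _) = (fun t => \sum_j M i j * x t j 0)).
  by apply: ac_sum => j; apply: ac_mul => //; exact: ac_cst.
by apply/funext => t; rewrite mxE.
Qed.

Lemma coord_derive_mul m k (M : 'M[R]_(m, k)) x (t : R) x' : coord_derive x t x' ->
  coord_derive (fun s => M *m x s) t (M *m x').
Proof.
move=> dx i; rewrite mxE (_ : (fun s => _) = (fun s => \sum_j M i j * x s j 0)).
  apply: is_derive_bigsum => j.
  have d1 := dx j; have := is_deriveM (is_derive_cst (M i j) t 1) d1 => h.
  by apply: is_derive_eq h _; rewrite scaler0 addr0.
by apply/funext => s; rewrite mxE.
Qed.

End Trajectories.

Section LyapunovFunction.
Context {R : realType} {N n n2 : nat}.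
Local Notation state := 'cV[R]_(n + (1 + (1 + n2))).
Context (G : 'M[R]_(n2, n)) (P : 'I_N -> 'M[R]_n) (Pz : 'M[R]_n2).

(** The boundary-layer variable: [G] is [L^-1 H], so [w] vanishes where the
    fast state is at its quasi-steady value. *)
Definition st_w (s : state) : 'cV[R]_n2 := st_z s + G *m st_xi s.

Definition energy q (s : state) : R :=
  bform (P q) (st_xi s) (st_xi s) + bform Pz (st_w s) (st_w s).

Lemma st_xi_coord (y : R -> state) a b : coord_ac y a b ->
  coord_ac (fun t => st_xi (y t)) a b.
Proof.
by move=> acy i; under eq_fun do rewrite /st_xi mxE; exact: acy.
Qed.

Lemma st_z_coord (y : R -> state) a b : coord_ac y a b ->
  coord_ac (fun t => st_z (y t)) a b.
Proof.
by move=> acy i; under eq_fun do rewrite /st_z !mxE; exact: acy.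
Qed.

Lemma ac_st_q (y : R -> state) a b : coord_ac y a b -> ac (fun t => st_q (y t)) a b.
Proof. by move=> acy; under eq_fun do rewrite /st_q !mxE; exact: acy. Qed.

Lemma ac_st_tau (y : R -> state) a b : coord_ac y a b -> ac (fun t => st_tau (y t)) a b.
Proof. by move=> acy; under eq_fun do rewrite /st_tau !mxE; exact: acy. Qed.

Lemma st_xi_derive (y : R -> state) (t : R) y' : coord_derive y t y' ->
  coord_derive (fun s => st_xi (y s)) t (st_xi y').
Proof.
by move=> dy i; under eq_fun do rewrite /st_xi mxE; rewrite /st_xi mxE; exact: dy.
Qed.

Lemma st_z_derive (y : R -> state) (t : R) y' : coord_derive y t y' ->
  coord_derive (fun s => st_z (y s)) t (st_z y').
Proof.
by move=> dy i; under eq_fun do rewrite /st_z !mxE; rewrite /st_z !mxE; exact: dy.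
Qed.

Lemma derive_st_q (y : R -> state) (t : R) y' : coord_derive y t y' ->
  is_derive t 1 (fun s => st_q (y s)) (st_q y').
Proof.
by move=> dy; under eq_fun do rewrite /st_q !mxE; rewrite /st_q !mxE; exact: dy.
Qed.

Lemma derive_st_tau (y : R -> state) (t : R) y' : coord_derive y t y' ->
  is_derive t 1 (fun s => st_tau (y s)) (st_tau y').
Proof.
by move=> dy; under eq_fun do rewrite /st_tau !mxE; rewrite /st_tau !mxE; exact: dy.
Qed.

Context (T eta eps c a : R) (At : 'I_N -> 'M[R]_n) (B : 'I_N -> 'M[R]_(n, n2))
  (H : 'M[R]_(n2, n)) (L : 'M[R]_n2).
Hypotheses (eps_gt0 : 0 < eps) (c_ge0 : 0 <= c).
Hypotheses (P_pos : forall q, posdefmx (P q)) (Pz_pos : posdefmx Pz).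
Hypothesis LG : L *m G = H.
Hypothesis rate : forall q xi w,
  let xi' := (At q - B q *m G) *m xi + B q *m w in
  2 * bform (P q) xi xi' + 2 * bform Pz w (eps^-1 *: (L *m w) + G *m xi')
  + (a + c * eta) * (bform (P q) xi xi + bform Pz w w) <= 0.

Lemma energy_ge0 q s : 0 <= energy q s.
Proof. by rewrite addr_ge0// posdefmx_ge0. Qed.

(** The factor 1 / (1 + c tau) rises while the timer runs down; its relative
    growth, at most [c * eta], is part of the budget in [rate]. *)
Definition lyap q (s : state) : R := energy q s / (1 + c * st_tau s).

Lemma is_mode_inj (x : R) (i j : 'I_N) : is_mode x i -> is_mode x j -> i = j.
Proof.
by rewrite /is_mode => -> /eqP; rewrite eqr_nat eqSS => /eqP/val_inj.
Qed.

Definition in_mode (q : 'I_N) (s : state) := is_mode (st_q s) q /\ 0 <= st_tau s <= T.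

Definition flows (y : R -> state) (t1 t2 : R) :=
  {ae lebesgue_measure, forall t : R, t \in `[t1, t2] ->
     sw_flow_set (N := N) T (y t) /\
     exists2 y', is_derive t 1 y y' & sw_flow_map eta eps At B H L (y t) y'}.

Section Flow.
Variables (y : R -> state) (t1 t2 : R).
Hypotheses (t12 : t1 <= t2) (acy : abs_continuous y t1 t2) (fl : flows y t1 t2).

Lemma flows_sub t : t1 <= t <= t2 -> abs_continuous y t1 t /\ flows y t1 t.
Proof.
move=> /andP[t1t tt2]; split.
  move=> e /acy[d d0 Hd]; exists d => // k u v uv; apply: Hd => i /uv[? [? vt]].
  by do 2!split => //; exact: le_trans tt2.
apply: (ae_imply fl) => s + s1; apply; move: s1; rewrite !in_itv/= => /andP[-> st].
exact: le_trans tt2.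
Qed.

Lemma flow_keeps_mode : st_q (y t2) = st_q (y t1).
Proof.
have acq := ac_st_q (abs_continuous_coord acy).
have dq t : (sw_flow_set (N := N) T (y t) /\
     exists2 y', is_derive t 1 y y' & sw_flow_map eta eps At B H L (y t) y') ->
    is_derive t 1 (fun s => st_q (y s)) 0.
  by move=> [_ [y' /is_derive_coord/derive_st_q + [i _ [_ <-]]]].
apply/le_anti/andP; split.
  apply: (ac_derive_nonincreasing t12 acq).
  by apply: (ae_imply fl) => t /[apply] /dq ?; exists 0.
rewrite -lerN2; apply: (@ac_derive_nonincreasing _ (fun t => - st_q (y t)) _ _ t12).
  apply: (@ac_lipschitz _ (fun t => st_q (y t)) -%R 1) => // u v _ _ _.
  by rewrite mul1r -opprD normrN.
apply: (ae_imply fl) => t /[apply] /dq dt; exists 0 => //.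
by rewrite -oppr0; exact: is_deriveN.
Qed.

Lemma flow_timer_decreases : st_tau (y t2) <= st_tau (y t1).
Proof.
apply: (ac_derive_nonincreasing t12 (ac_st_tau (abs_continuous_coord acy))).
apply: (ae_imply fl) => t /[apply] -[_ [y' /is_derive_coord/derive_st_tau dt]].
by move=> [i _ [_ _ /andP[_ t0] _]]; exists (st_tau y').
Qed.

(** The bound on the timer holds almost everywhere only; a negative value would
    persist on an interval to the left, by continuity. *)
Lemma flow_timer_ge0 : 0 <= st_tau (y t1) -> 0 <= st_tau (y t2).
Proof.
move=> tau1; move: t12; rewrite le_eqVlt => /orP[/eqP <-//|t12'].
rewrite leNgt; apply/negP => tau2.
have tau20 : 0 < - st_tau (y t2) by rewrite oppr_gt0.
have [d d0 Hd] :=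
  ac_small_increments (ac_st_tau (abs_continuous_coord acy)) tau20.
(* Half of [d] keeps the witness within distance [d] of [t2]. *)
have [||t /andP[ut tt2] [[_ /andP[t0 _]] _]] :=
    @ae_itv_witness _ _ _ _ (Num.max t1 (t2 - d / 2)) t2 fl _ _ (lexx _).
- by rewrite le_max lexx.
- by rewrite gt_max t12'/=; lra.
move: ut; rewrite ge_max => /andP[t1t dt].
have := Hd t t2 t1t tt2 (lexx _); have -> : t2 - t < d by lra.
by move=> /(_ isT); rewrite ltr_norml; lra.
Qed.

End Flow.

Variables (y : R -> state) (t1 t2 : R) (q : 'I_N).
Hypotheses (t12 : t1 <= t2) (acy : abs_continuous y t1 t2) (fl : flows y t1 t2).
Hypothesis y1 : in_mode q (y t1).

Lemma flow_in_mode t : t1 <= t <= t2 -> in_mode q (y t).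
Proof.
move=> tt; have [act flt] := flows_sub acy fl tt.
have t1t : t1 <= t by case/andP: tt.
have [mq /andP[t0 tT]] := y1; split.
  by rewrite (flow_keeps_mode t1t act flt).
rewrite (flow_timer_ge0 t1t act flt t0)/=.
exact: le_trans (flow_timer_decreases t1t act flt) tT.
Qed.

(** With h = 1 / (1 + c tau), the derivative of exp (a t) h E is exp (a t) h times
    E' + a E - c tau' h E, and the last term is at most c eta E because
    h <= 1 and - tau' <= eta; [rate] bounds the total by 0. *)
Lemma lyap_flow_decay : expR (a * t2) * lyap q (y t2) <= expR (a * t1) * lyap q (y t1).
Proof.
have accy := abs_continuous_coord acy.
have acxi := st_xi_coord accy.
have acw : coord_ac (fun t => st_w (y t)) t1 t2.
  by apply: coord_ac_add; [exact: st_z_coord | exact: coord_ac_mul].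
have den t : t1 <= t <= t2 -> 1 <= 1 + c * st_tau (y t).
  by move=> /flow_in_mode[_ /andP[t0 _]]; rewrite lerDl mulr_ge0.
pose V t := expR (a * t) * (energy q (y t) * (1 + c * st_tau (y t))^-1).
suff : V t2 <= V t1 by [].
have acV : ac V t1 t2.
  apply: ac_mul; first exact: ac_expR.
  apply: ac_mul; first by apply: ac_add; exact: ac_bform.
  apply: (@ac_lipschitz _ (fun t => st_tau (y t)) (fun u => (1 + c * u)^-1) c); last first.
    exact: ac_st_tau.
  move=> u v t1u uv vt2.
  have du := den u; rewrite t1u (le_trans uv vt2) in du; move: du => /(_ isT) du.
  have dv := den v; rewrite (le_trans t1u uv) vt2 in dv; move: dv => /(_ isT) dv.
  set p := 1 + c * st_tau (y v) in dv *; set r := 1 + c * st_tau (y u) in du *.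
  have p0 : 0 < p by lra.
  have r0 : 0 < r by lra.
  have -> : p^-1 - r^-1 = - (c * (st_tau (y v) - st_tau (y u))) / (p * r).
    by rewrite /p /r; field; rewrite -/p -/r !gt_eqF.
  rewrite normrM normrN normrM (ger0_norm c_ge0) (@ger0_norm _ (p * r)^-1); last first.
    by rewrite invr_ge0 mulr_ge0// ltW.
  by rewrite ler_pdivrMr ?mulr_gt0// ler_peMr ?mulr_ge0// -[1]mulr1 ler_pM.
apply: (ac_derive_nonincreasing t12 acV).
apply: (ae_imply fl) => t + tI; move=> /(_ tI)[_ [y' dy [i mi [xi' _ tau' z']]]].
have tt : t1 <= t <= t2 by move: tI; rewrite in_itv.
have [mq _] := flow_in_mode tt.
have iq := is_mode_inj mi mq; rewrite {i mi}iq in xi'.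
have cdy := is_derive_coord dy.
have dxi := st_xi_derive cdy; have dtau := derive_st_tau cdy.
have dw : coord_derive (fun s => st_w (y s)) t (st_z y' + G *m st_xi y').
  by apply: coord_derive_add; [exact: st_z_derive | exact: coord_derive_mul].
set x := st_xi (y t) in xi' z'; set w := st_w (y t).
have zE : st_z (y t) = w - G *m x by rewrite /w /st_w addrK.
have xiE : st_xi y' = (At q - B q *m G) *m x + B q *m w.
  by rewrite xi' zE mulmxBl mulmxBr mulmxA -!addrA (addrC (B q *m w)).
have wE : st_z y' + G *m st_xi y' = eps^-1 *: (L *m w) + G *m st_xi y'.
  congr (_ + _); rewrite -[LHS](@scalerK _ _ eps) ?unitfE ?gt_eqF//.
  by rewrite z' zE mulmxBr mulmxA LG addrCA subrr addr0.
have dnum : is_derive t 1 (fun s => energy q (y s))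
    (2 * bform (P q) x (st_xi y') + 2 * bform Pz w (st_z y' + G *m st_xi y')).
  have := is_deriveD (derive_bform (P q) dxi dxi) (derive_bform Pz dw dw) => h.
  apply: is_derive_eq h _; rewrite -/x -/w.
  rewrite -(bform_tr (P q) (st_xi y') x) -(bform_tr Pz (_ + _) w).
  by rewrite (P_pos q).1 Pz_pos.1; ring.
have dexp : is_derive t 1 (fun s => expR (a * s)) (a * expR (a * t)).
  have da : is_derive t 1 (fun s : R => a * s) a.
    have := is_deriveM (is_derive_cst a t (1 : R)) (is_derive_id t (1 : R)) => h.
    by apply: is_derive_eq h _; rewrite scaler0 addr0 /GRing.scale/= mulr1.
  have := is_derive1_comp (is_derive_expR (a * t)) da => h.
  by apply: is_derive_eq h _; rewrite mulrC.
have p1 := den t tt; set p := 1 + c * st_tau (y t) in p1.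
have p0 : 0 < p by lra.
have dden : is_derive t 1 (fun s => 1 + c * st_tau (y s)) (c * st_tau y').
  have := is_deriveD (is_derive_cst (1 : R) t (1 : R)) (is_deriveM (is_derive_cst c t (1 : R)) dtau) => h.
  by apply: is_derive_eq h _; rewrite scaler0 addr0 add0r.
have pn0 : 1 + c * st_tau (y t) != 0 by rewrite gt_eqF.
have dV := is_deriveM dexp (is_deriveM dnum (@is_deriveV R (fun s => 1 + c * st_tau (y s)) _ _ _ pn0 dden)).
eexists; first exact: dV.
rewrite /GRing.scale/= -/p.
have := rate q x w; rewrite /= -xiE -wE.
set E' := 2 * _ + _; set E := energy q (y t).
have -> : bform (P q) x x + bform Pz w w = E by [].
have E0 : 0 <= E by exact: energy_ge0.
move=> rt.
have e0 := expR_gt0 (a * t); set e := expR (a * t) in e0 *.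
have -> : e * (E * (- p ^- 2 * (c * st_tau y')) + p^-1 * E') + E * p^-1 * (a * e) =
    (e / p) * (E' + a * E + (- st_tau y') * (c / p) * E).
  by field; rewrite gt_eqF.
rewrite pmulr_rle0 ?divr_gt0//.
have : (- st_tau y') * (c / p) * E <= eta * c * E.
  rewrite ler_wpM2r//; case/andP: tau' => tl tu; rewrite ler_pM ?oppr_ge0 ?divr_ge0//.
  - exact: ltW.
  - by rewrite lerNl.
  - by rewrite ler_pdivrMr// ler_peMr.
by move: rt; rewrite mulrDl; lra.
Qed.

End LyapunovFunction.

(** * Jump times and values at jumps *)

Section JumpTimes.
Context {R : realType}.

(** [t] lists the jump times of [E].  Only the relations that hold in all three
    shapes of a hybrid time domain are kept, so that later arguments need
    not distinguish how the domain ends. *)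
Definition jump_times (E : set (R * nat)) (t : nat -> R) : Prop :=
  [/\ t 0%N = 0,
      forall j, t j <= t j.+1,
      forall s j, E (s, j) -> t j <= s /\ forall u, t j <= u -> u <= s -> E (u, j) &
      forall s j, E (s, j.+1) ->
        [/\ E (t j.+1, j), E (t j.+1, j.+1) & forall u, E (u, j) -> u <= t j.+1]].

Lemma hybrid_time_domain_jump_times (E : set (R * nat)) :
  hybrid_time_domain E -> exists t, jump_times E t.
Proof.
move=> [t [t0 tS HE]]; exists t; split => //.
- move=> s j; case: HE => [->|[J ->]|[J [tbar [Jt ->]]]].
  + move=> [i _ [/= + ->]]; rewrite in_itv/= => /andP[ts st]; split => // u tu us.
    by exists i => //=; split => //=; rewrite in_itv/= tu (le_trans us).
  + move=> [i Ji [/= + ->]]; rewrite in_itv/= => /andP[ts st]; split => // u tu us.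
    by exists i => //=; split => //=; rewrite in_itv/= tu (le_trans us).
  + move=> [[i Ji [/= + ->]]|[/= [ts st] ->]].
      rewrite in_itv/= => /andP[ts st]; split => // u tu us.
      by left; exists i => //=; split => //=; rewrite in_itv/= tu (le_trans us).
    split => // u tu us; right; split => //=; split => //.
    by apply: le_lt_trans st; rewrite lee_fin.
- move=> s j; case: HE => [->|[J ->]|[J [tbar [Jt ->]]]].
  + move=> _; split.
    * by exists j => //=; split => //=; rewrite in_itv/= tS lexx.
    * by exists j.+1 => //=; split => //=; rewrite in_itv/= tS lexx.
    * by move=> u [i _ [/= + ->]]; rewrite in_itv/= => /andP[].
  + move=> [i /= Ji [/= _ ji]]; rewrite -ji in Ji; split.
    * by exists j => /=; [exact: ltnW|split => //=; rewrite in_itv/= tS lexx].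
    * by exists j.+1 => //=; split => //=; rewrite in_itv/= tS lexx.
    * by move=> u [k _ [/= + ->]]; rewrite in_itv/= => /andP[].
  + move=> H.
    have jJ : (j < J)%N.
      case: H => [[i /= Ji [/= _ ji]]|[/= _ <-]]; last exact: ltnSn.
      by rewrite -ji in Ji; exact: ltnW.
    split.
    * by left; exists j => //=; split => //=; rewrite in_itv/= tS lexx.
    * case: H => [[i /= Ji [/= _ ji]]|[/= _ ->]]; last by right; split => //=; split.
      by left; exists i => //=; split => //=; rewrite ji in_itv/= tS lexx.
    * move=> u [[k _ [/= + ->]]|[/= _ jE]]; first by rewrite in_itv/= => /andP[].
      by rewrite jE ltnn in jJ.
Qed.

End JumpTimes.

Section EndpointValue.
Context {R : realType} {m : nat} d (Omega : measurableType d).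
Context (Gam : Omega -> set (R * nat * 'cV[R]_m)).
Context (j : nat) (phi : R * 'cV[R]_m -> R).

Definition meets_after (r : R) (w : Omega) :=
  exists p, [/\ Gam w p, p.1.2 = j & r < p.1.1].

Definition exceeds_after (r c : R) (w : Omega) :=
  exists p, [/\ Gam w p, p.1.2 = j, r < p.1.1 & c < phi (p.1.1, p.2)].

(** The upper limit of [phi] at the right end of level [j].  Whether a jump
    happens may depend on the input that the jump consumes, so the last point of
    the level is not known beforehand as a jump point; this quantity only
    depends on the graph up to level [j]. *)
Definition endpoint_value (w : Omega) : \bar R :=
  ereal_inf [set c%:E | c in
    [set c | exists r, meets_after r w /\ ~ exceeds_after r c w]].

Hypothesis phi_cont : continuous phi.
Hypothesis Gam_meas : set_valued_measurable measurable Gam.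

Lemma open_level : open [set p : R * nat * 'cV[R]_m | p.1.2 = j].
Proof.
have -> : [set p : R * nat * 'cV[R]_m | p.1.2 = j] = (fun p => p.1.2) @^-1` [set j] by [].
apply: open_comp; last exact: discrete_open.
by move=> p _; apply: continuous_comp; [exact: cvg_fst|exact: cvg_snd].
Qed.

Lemma continuous_time_state :
  continuous (fun p : R * nat * 'cV[R]_m => (p.1.1, p.2)).
Proof.
move=> p.
have h1 : (fun p : R * nat * 'cV[R]_m => p.1.1) @ p --> p.1.1.
  by apply: (@continuous_comp _ _ _ fst fst); exact: cvg_fst.
have h2 : (fun p : R * nat * 'cV[R]_m => p.2) @ p --> p.2 by exact: cvg_snd.
exact: (cvg_pair h1 h2).
Qed.

Lemma measurable_level_hit (O : set (R * 'cV[R]_m)) : open O ->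
  measurable [set w | exists p, [/\ Gam w p, p.1.2 = j & O (p.1.1, p.2)]].
Proof.
move=> oO; have := Gam_meas (openI open_level
  (open_comp (fun p _ => @continuous_time_state p) oO)).
congr (measurable _); apply/funext => w; apply/propext; split.
- by move=> [p [Gp [jp Op]]]; exists p.
- by move=> [p [Gp jp Op]]; exists p.
Qed.

Lemma open_after (r : R) : open [set p : R * 'cV[R]_m | r < p.1].
Proof.
have -> : [set p : R * 'cV[R]_m | r < p.1] = fst @^-1` [set x | r < x] by [].
by apply: open_comp; [move=> p _; exact: cvg_fst | exact: open_gt].
Qed.

(** Rational times and rational bounds suffice in the definition. *)
Lemma measurable_endpoint_value : measurable_fun [set: Omega] (endpoint_value : Omega -> \bar R).
Proof.
apply: (measurability _ (ErealGenInftyO.measurableE R)) => //.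
move=> _ [_ [y ->] <-]; rewrite setTI.
have -> : endpoint_value @^-1` `]-oo, y%:E[ =
    \bigcup_(r in [set: rat]) \bigcup_(c in [set c : rat | ratr c < y])
      ([set w | meets_after (ratr r) w] `&` ~` [set w | exceeds_after (ratr r) (ratr c) w]).
  apply/seteqP; split => w /=.
    rewrite in_itv/= => /ereal_inf_lt[_ [c [r [[p [Gp pj rp]] nex]] <-] cy].
    have [r' /andP[rr' r'p]] : exists r' : rat, r < ratr r' < p.1.1.
      by have [r' ] := rat_in_itvoo rp; rewrite in_itv/=; exists r'.
    rewrite lte_fin in cy.
    have [c' /andP[cc' c'y]] : exists c' : rat, c < ratr c' < y.
      by have [c'] := rat_in_itvoo cy; rewrite in_itv/=; exists c'.
    exists r' => //; exists c' => //; split; first by exists p.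
    move=> [p' [Gp' p'j r'p' c'p']]; apply: nex; exists p'; split => //.
    - exact: lt_trans r'p'.
    - exact: lt_trans c'p'.
  move=> [r _ [c /= cy [mr nex]]]; rewrite in_itv/=; apply: (@le_lt_trans _ _ (ratr c)%:E); last by rewrite lte_fin.
  by apply: ereal_inf_lbound; exists (ratr c) => //; exists (ratr r).
apply: bigcupT_measurable_rat => r; rewrite bigcup_mkcond.
apply: bigcupT_measurable_rat => c; case: ifPn => // _.
apply: measurableI; first exact: (measurable_level_hit (@open_after (ratr r))).
apply: measurableC.
have -> : [set w | exceeds_after (ratr r) (ratr c) w] = [set w | exists p,
    [/\ Gam w p, p.1.2 = j & ([set p | ratr r < p.1] `&` phi @^-1` [set x | ratr c < x])
      (p.1.1, p.2)]].
  apply/funext => w; apply/propext; split.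
  - by move=> [p [? ? ? ?]]; exists p.
  - by move=> [p [? ? [? ?]]]; exists p.
apply: measurable_level_hit; apply: openI; first exact: (@open_after (ratr r)).
by apply: open_comp; [move=> p _; exact: phi_cont | exact: open_gt].
Qed.


(** A level that a jump leaves contains its right end, and arcs are
    continuous there from the left. *)
Lemma endpoint_value_jump (y : hybrid_arc R m) (t : nat -> R) (w : Omega) (l : nat) :
  (j <= l)%N -> Gam w = graph_upto l y ->
  jump_times (arc_dom y) t -> arc_dom y (t j.+1, j.+1) ->
  endpoint_value w = (phi (t j.+1, arc_val y (t j.+1) j))%:E.
Proof.
move=> jl GE [_ _ level jump] dom'.
have [dome _ ub] := jump _ _ dom'; have [tj lev] := level _ _ dome.
set e := t j.+1 in dom' dome ub tj lev *.
have Ge : Gam w (e, j, arc_val y e j) by rewrite GE; split.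
apply/le_anti/andP; split; last first.
  apply: le_ereal_inf_tmp => _ [c [r [[p [Gp pj rp]] nex]] <-]; rewrite lee_fin leNgt.
  apply/negP => cphi; apply: nex; exists (e, j, arc_val y e j); split => //=.
  apply: (lt_le_trans rp); apply: ub; rewrite -pj.
  by move: Gp; rewrite GE => -[[+ _] _]; case: p.1.
apply/lee_addgt0Pr => eps eps0; rewrite -EFinD.
have [d1 d10 Hphi] : exists2 d1, 0 < d1 & forall u, `|e - u| < d1 ->
    enorm (arc_val y e j - arc_val y u j) < d1 -> phi (u, arc_val y u j) < phi (e, arc_val y e j) + eps.
  have /cvgrPdist_lt/(_ _ eps0)/nbhs_ballP[d1 /= d10 H] :=
    @phi_cont (e, arc_val y e j).
  exists d1 => // u eu yu; have := H (u, arc_val y u j); rewrite /=.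
  have bl : ball (e, arc_val y e j) d1 (u, arc_val y u j).
    split => //=; split => // i k; rewrite (ord1 k); apply: le_lt_trans yu.
    by apply: le_trans (coord_le_enorm _ i); rewrite !mxE.
  move=> /(_ bl); by rewrite ltr_distlC => /andP[].
have sub : `[t j, e] `<=` [set t | arc_dom y (t, j)].
  by move=> u /=; rewrite in_itv/= => /andP[tu ue]; exact: lev.
have [d2 d20 Hac] := arc_valP tj sub d10.
pose r := e - Num.min d1 d2.
have dm : 0 < Num.min d1 d2 by rewrite lt_min d10 d20.
apply: ereal_inf_lbound; exists (phi (e, arc_val y e j) + eps) => //.
exists r; split; first by exists (e, j, arc_val y e j); split => //=; rewrite ltrBlDr ltrDl.
move=> [[[u j'] s] [/= Gp jE ru]]; rewrite {}jE in Gp.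
move: Gp; rewrite GE => -[[/= domu ->] _]; apply/negP; rewrite -leNgt.
have ue := ub _ domu; have [tu _] := level _ _ domu.
have um : e - u < Num.min d1 d2 by rewrite ltrBlDr -ltrBlDl.
move: um; rewrite lt_min => /andP[um1 um2].
apply/ltW/Hphi; first by rewrite ger0_norm ?subr_ge0.
have := Hac 1%N (fun=> u) (fun=> e); rewrite !big_ord1 => /(_ _ _ um2) Hn.
apply: Hn; first by move=> i _; rewrite tu ue.
by move=> [|i] [|k].
Qed.

End EndpointValue.

(** * Measurability of hitting a closed set *)

Section ClosedHits.
Context {R : realType}.

(** A cluster point of the points of [K] that come ever closer to [F] belongs
    to both sets. *)
Lemma compact_meets_of_near (V : pseudoMetricType R) (K F : set V) :
  compact K -> closed F ->
  (forall i : nat, exists p q, [/\ K p, F q & ball p i.+1%:R^-1 q]) ->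
  K `&` F !=set0.
Proof.
move=> cK cF near_hit.
pose p i := sval (cid (near_hit i)).
have pP i : K (p i) /\ exists q, F q /\ ball (p i) i.+1%:R^-1 q.
  by rewrite /p; case: cid => /= x [q [? ? ?]]; split => //; exists q.
have [x [Kx clx]] : K `&` cluster (p @ \oo) !=set0.
  by apply: cK; exists 0%N => // i _; exact: (pP i).1.
exists x; split => //; apply: cF => B /nbhs_ballP[e /= e0 xeB].
pose M := Num.truncn (e / 2)^-1.
have tail : (p @ \oo) [set p i | i in [set i | (M <= i)%N]].
  by exists M => // i /= Mi; exists i.
have [_ [[i /= Mi <-] xpi]] := clx _ _ tail (nbhsx_ballx x (e / 2) (divr_gt0 e0 (ltr0Sn _ 1))).
have [_ [q [Fq pq]]] := pP i.
exists q; split => //; apply: xeB; rewrite (splitr e).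
apply: (ball_triangle xpi); apply: le_ball pq.
rewrite -[leRHS]invrK lef_pV2 ?posrE ?invr_gt0 ?divr_gt0//.
apply: (le_trans (ltW (truncnS_gt _))); by rewrite ler_nat.
Qed.

Definition box m (k : R) : set (R * 'cV[R]_m) :=
  `[- k, k]%classic `*` [set s : 'cV[R]_m | forall i, - k <= s i 0 <= k].

Lemma continuous_trmx_row m : continuous (fun v : 'rV[R]_m => (v^T : 'cV[R]_m)).
Proof.
move=> v A /nbhs_ballP[e /= e0 vA]; apply/nbhs_ballP; exists e => //= u [_ uv].
by apply: vA; split => // i j; rewrite !mxE.
Qed.

Lemma compact_box m k : compact (@box m k).
Proof.
apply: compact_setX; first exact: segment_compact.
have := @rV_compact R m (fun=> `[- k, k]%classic) (fun=> @segment_compact _ _ _) => cr.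
have := @continuous_compact _ _ (fun v : 'rV[R]_m => (v^T : 'cV[R]_m)) _
  (continuous_subspaceT (@continuous_trmx_row m)) cr.
congr (compact _); apply/seteqP; split.
  by move=> _ [v /= vk <-] i; have := vk i; rewrite in_itv/= !mxE.
move=> s /= sk; exists s^T; last by rewrite trmxK.
by move=> i; rewrite /= in_itv/= mxE; exact: sk.
Qed.

Lemma box_cover m (p : R * 'cV[R]_m) : exists k : nat, @box m k%:R p.
Proof.
pose M := `|p.1| + enorm p.2.
have e0 : 0 <= enorm p.2 by exact: sqrtr_ge0.
exists (Num.truncn M).+1; have lM := ltW (truncnS_gt M).
split; rewrite /= ?in_itv/=.
  by rewrite -ler_norml; apply: le_trans lM; rewrite lerDl.
move=> i; rewrite -ler_norml; apply: le_trans lM.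
by apply: (le_trans (coord_le_enorm _ i)); rewrite lerDr.
Qed.

Context {m : nat} {d} {Omega : measurableType d}.
Context (Gam : Omega -> set (R * nat * 'cV[R]_m)).
Hypothesis Gam_meas : set_valued_measurable measurable Gam.
Hypothesis Gam_closed : forall w, closed (Gam w).

Lemma closed_level w j : closed [set p : R * 'cV[R]_m | Gam w (p.1, j, p.2)].
Proof.
have -> : [set p : R * 'cV[R]_m | Gam w (p.1, j, p.2)] =
  (fun p : R * 'cV[R]_m => (p.1, j, p.2)) @^-1` Gam w by [].
apply: (closed_comp _ (@Gam_closed w)) => p _.
have h1 : (fun p : R * 'cV[R]_m => p.1) @ p --> p.1 by exact: cvg_fst.
have h2 : (fun p : R * 'cV[R]_m => p.2) @ p --> p.2 by exact: cvg_snd.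
exact: (cvg_pair (cvg_pair h1 (cvg_cst j)) h2).
Qed.

(** Measurability of a set-valued map only speaks of open sets.  A closed set is a countable union
    of compact ones, and a closed value meets a compact set as soon as
    it meets all its neighborhoods of radius 1 / (i + 1). *)
Lemma measurable_closed_hit (K : nat -> set (R * 'cV[R]_m)) :
  (forall j, closed (K j)) ->
  measurable [set w | exists p, Gam w p /\ K p.1.2 (p.1.1, p.2)].
Proof.
move=> cK.
pose O j k i := \bigcup_(p in K j `&` @box m k%:R) (ball p i.+1%:R^-1)^°.
have -> : [set w | exists p, Gam w p /\ K p.1.2 (p.1.1, p.2)] =
    \bigcup_j \bigcup_k \bigcap_i
      [set w | exists p, [/\ Gam w p, p.1.2 = j & O j k i (p.1.1, p.2)]].
  apply/seteqP; split => w /=.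
    move=> [[[t j] s] [/= Gp Kp]]; have [k boxk] := box_cover (t, s).
    exists j => //; exists k => // i _; exists (t, j, s); split => //.
    exists (t, s); first by split.
    by apply: nbhs_singleton; apply: nbhs_interior; exact: nbhsx_ballx.
  move=> [j _ [k _ H]].
  have [|||x [[Kx _] Gx]] := @compact_meets_of_near _ (K j `&` @box m k%:R)
      [set p : R * 'cV[R]_m | Gam w (p.1, j, p.2)].
  - rewrite setIC; apply: compact_closedI => //; exact: compact_box.
  - exact: closed_level.
  - move=> i; have [[[t j'] s] [/= Gp jE]] := H i Logic.I; rewrite jE in Gp.
    move=> [p Kp /interior_subset pb]; exists p, (t, s); split => //.
  - by exists (x.1, j, x.2) => /=; split => //; case: x Kx Gx.
apply: bigcupT_measurable => j; apply: bigcupT_measurable => k.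
apply: bigcapT_measurable => i.
have oO : open (O j k i) by apply: bigcup_open => p _; exact: open_interior.
 exact: (measurable_level_hit _ Gam_meas oO).
Qed.

End ClosedHits.

Lemma continuous_finsum (R : realType) (V : topologicalType) (I : finType)
    (f : I -> V -> R) :
  (forall i, continuous (f i)) -> continuous (fun x => \sum_i f i x).
Proof.
move=> cf; have -> : (fun x => \sum_i f i x) = \sum_i f i.
  by apply/funext => t; rewrite fct_sumE.
elim/big_rec: _ => [x|i g _ cg x]; first exact: cvg_cst.
by apply: continuousD; [exact: cf | exact: cg].
Qed.

Section InflateTopology.
Context {R : realType} {m : nat}.

Lemma continuous_enorm : continuous (@enorm R m).
Proof.
move=> x; apply: continuous_comp; last exact: sqrt_continuous.
apply: (@continuous_finsum R _ _ (fun i (y : 'cV[R]_m) => y i 0 ^+ 2)) => i {}x.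
by under eq_fun do rewrite expr2; apply: continuousM; exact: coord_continuous.
Qed.

Lemma inflateE (A : set 'cV[R]_m) (e : R) : 0 < e ->
  inflate A e = [set y | exists2 s, A s & enorm (y - s) < e].
Proof.
have enormZ c (x : 'cV[R]_m) : 0 <= c -> enorm (c *: x) = c * enorm x.
  move=> c0; rewrite /enorm.
  have -> : \sum_i (c *: x) i 0 ^+ 2 = c ^+ 2 * \sum_i x i 0 ^+ 2.
    by rewrite mulr_sumr; apply: eq_bigr => i _; rewrite mxE exprMn.
  by rewrite sqrtrM ?sqr_ge0// sqrtr_sqr ger0_norm.
move=> e0; apply/seteqP; split => y /=.
  move=> [s As [b b1 <-]]; exists s => //.
  by rewrite addrAC subrr add0r enormZ ?ltW// gtr_pMr.
move=> [s As sy]; exists s => //; exists (e^-1 *: (y - s)).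
  by rewrite /= enormZ ?invr_ge0 ?ltW// mulrC ltr_pdivrMr// mul1r.
by rewrite scalerA mulfV ?gt_eqF// scale1r addrC subrK.
Qed.

Lemma open_inflate (A : set 'cV[R]_m) (e : R) : 0 < e -> open (inflate A e).
Proof.
move=> e0; rewrite inflateE//.
have -> : [set y | exists2 s, A s & enorm (y - s) < e] =
    \bigcup_(s in A) ((fun y => enorm (y - s)) @^-1` [set x | x < e]).
  by apply/seteqP; split => y [s As ys]; exists s.
apply: bigcup_open => s _; apply: open_comp; last exact: open_lt.
move=> y _.
have h : (fun z : 'cV[R]_m => z - s) @ y --> y - s.
  exact: (@cvgB _ _ _ (nbhs y) _ id (fun=> s) y s cvg_id (cvg_cst s)).
exact: (continuous_comp h (@continuous_enorm _)).
Qed.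

End InflateTopology.

(** * A maximal inequality for processes driven by independent inputs *)

Section Ville.
Local Open Scope ereal_scope.
Context {R : realType} {d} {Omega : measurableType d} (P : probability Omega R).
Context (F : nat -> set (set Omega)) (U : nat -> Omega -> \bar R) (K : R).
Hypothesis F_measurable : forall l, F l `<=` measurable.
Hypothesis F_mono : forall l, F l `<=` F l.+1.
Hypothesis F_setT : forall l, F l setT.
Hypothesis F_setI : forall l A B, F l A -> F l B -> F l (A `&` B).
Hypothesis F_setC : forall l A, F l A -> F l (~` A).
Hypothesis U_ge0 : forall l w, 0 <= U l w.
Hypothesis U_meas : forall l, measurable_fun [set: Omega] (U l).
Hypothesis U_level : forall l, F l [set w | K%:E <= U l w].
Hypothesis U_super : forall l A, F l A ->
  \int[P]_(w in A) U l.+1 w <= \int[P]_(w in A) U l w.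
Hypothesis K_ge0 : (0 <= K)%R.

Let hit l := [set w | K%:E <= U l w].

Let mhit l : measurable (hit l).
Proof. exact: F_measurable (U_level l). Qed.

Let mU l (A : set Omega) : measurable_fun A (U l).
Proof. exact: measurable_funTS. Qed.

(** Doob's stopping argument, by induction on the horizon: where the level is
    reached now, Markov's inequality applies; elsewhere wait one step, which does
    not increase the integral over an event decided so far. *)
Lemma ville_finite k : forall l A, F l A ->
  K%:E * P (A `&` \bigcup_(i in `I_k) hit (l + i)%N) <= \int[P]_(w in A) U l w.
Proof.
elim: k => [|k IH] l A FA.
  by rewrite II0 bigcup_set0 setI0 measure0 mule0 integral_ge0.
have mA := F_measurable FA.
have FD : F l (A `&` ~` hit l) by apply: F_setI => //; exact/F_setC/U_level.
have split_ : A `&` \bigcup_(i in `I_k.+1) hit (l + i)%N `<=`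
    (A `&` hit l) `|` ((A `&` ~` hit l) `&` \bigcup_(i in `I_k) hit (l.+1 + i)%N).
  move=> w [Aw [[|i] /= ik Hw]]; first by left; rewrite addn0 in Hw.
  have [hl|hl] := pselect (hit l w); first by left.
  by right; split => //; exists i => //=; rewrite addSnnS.
have mbig : measurable (\bigcup_(i in `I_k) hit (l.+1 + i)%N).
  by apply: bigcup_measurable => i _; exact: mhit.
apply: (@le_trans _ _ (K%:E * (P (A `&` hit l) +
    P ((A `&` ~` hit l) `&` \bigcup_(i in `I_k) hit (l.+1 + i)%N)))).
  rewrite lee_wpmul2l ?lee_fin//; apply: le_trans (measureU2 _ _ _).
  - apply: le_measure; rewrite ?inE//.
    + by apply: measurableI => //; apply: bigcup_measurable => i _; exact: mhit.
    + by apply: measurableU; repeat apply: measurableI => //; exact: measurableC.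
  - exact: measurableI.
  - by repeat apply: measurableI => //; exact: measurableC.
rewrite ge0_muleDr ?measure_ge0//.
have -> : \int[P]_(w in A) U l w =
    \int[P]_(w in A `&` hit l) U l w + \int[P]_(w in A `&` ~` hit l) U l w.
  rewrite -ge0_integral_setU//.
  - by congr (integral _ _ _); rewrite -setIUr setUv setIT.
  - exact: measurableI.
  - by apply: measurableI => //; exact: measurableC.
  - by apply/disj_set2P; rewrite setIACA setICr setI0.
apply: leeD; last first.
  by apply: (le_trans (IH l.+1 _ (F_mono FD))); exact: U_super.
rewrite -integral_cst//; last exact: measurableI.
apply: ge0_le_integral => //; first exact: measurableI.
by move=> w [_].
Qed.

Lemma ville : K%:E * P (\bigcup_l hit l) <= \int[P]_w U 0%N w.
Proof.
have -> : \bigcup_l hit l = \bigcup_k (\bigcup_(i in `I_k) hit i).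
  apply/seteqP; split => w [k _ Hk]; first by exists k.+1 => //; exists k => //=.
  by case: Hk => i _ Hi; exists i.
have mk k : measurable (\bigcup_(i in `I_k) hit i).
  by apply: bigcup_measurable => i _; exact: mhit.
have nd : nondecreasing_seq (fun k => \bigcup_(i in `I_k) hit i).
  move=> k k' kk'; apply/subsetPset => w [i /= ik Hi].
  by exists i => //=; exact: leq_trans kk'.
have cv := nondecreasing_cvg_mu mk (bigcupT_measurable _ mk) nd.
have cvK := cvgeZl (erefl : K%:E \is a fin_num) (cv _ P).
apply: (cvge_to_le cvK); apply: nearW => k /=.
by have := ville_finite k (F_setT 0%N); rewrite setTI.
Qed.

End Ville.

Section Independence.
Local Open Scope ereal_scope.
Context {R : realType} {d} {Omega : measurableType d} (P : probability Omega R).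

(** The joint law of the two maps is a product measure, because it agrees with
    one on rectangles; so the second map can be integrated out first. *)
Lemma integral_independent d1 d2 (X : measurableType d1) (V : measurableType d2)
    (pi : {mfun Omega >-> X}) (v : {mfun Omega >-> V}) (mu : probability V R)
    (f : X * V -> \bar R) :
  (forall A B, measurable A -> measurable B ->
     P (pi @^-1` A `&` v @^-1` B) = P (pi @^-1` A) * mu B) ->
  measurable_fun [set: X * V] f -> (forall z, 0 <= f z) ->
  \int[P]_w f (pi w, v w) = \int[P]_w \int[mu]_b f (pi w, b).
Proof.
move=> indep mf f0.
have mpv : measurable_fun [set: Omega] (fun w => (pi w, v w)).
  by apply/measurable_fun_pairP; split => /=; exact: measurable_funP.
pose pv : {mfun Omega >-> (X * V)%type} :=
  HB.pack (fun w => (pi w, v w)) (isMeasurableFun.Build _ _ _ _ _ mpv).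
transitivity (\int[distribution P pv]_z f z).
  by rewrite ge0_integral_distribution.
transitivity (\int[distribution P pi \x mu]_z f z).
  apply: eq_measure_integral => A mA _; symmetry.
  by apply: product_measure_unique => // B C mB mC; exact: indep.
rewrite fubini_tonelli1// ge0_integral_distribution//.
- exact: measurable_fun_fubini_tonelli_F.
- by move=> x; exact: integral_ge0.
Qed.

End Independence.

Section InputFiltration.
Local Open Scope ereal_scope.
Context {R : realType} {d} {Omega : measurableType d} (P : probability Omega R).
Context {dV} {V : measurableType dV} (mu : probability V R).
Context (v : nat -> {mfun Omega >-> V}).
Hypothesis iid : iid_inputs P mu v.

Definition past_generators l : set (set Omega) :=
  \bigcup_(k in `I_l) preimage_set_system setT (v k) measurable.

(** The same points as [Omega], with only the events decided by the first [l]
    inputs as measurable sets. *)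
Definition past l := g_sigma_algebraType (past_generators l).

Lemma input_filtration_measurable l : input_filtration v l `<=` measurable.
Proof.
apply: smallest_sub; first exact: sigma_algebra_measurable.
move=> A [k _ [B mB <-]]; rewrite setTI -[X in measurable X]setTI.
exact: measurable_funP.
Qed.

Lemma input_filtration_mono l : input_filtration v l `<=` input_filtration v l.+1.
Proof.
apply: sub_sigma_algebra2 => A [k /= kl H]; exists k => //=.
exact: ltnW.
Qed.

Lemma input_filtration_input l (B : set V) : measurable B ->
  input_filtration v l.+1 (v l @^-1` B).
Proof.
move=> mB; apply: sub_sigma_algebra; exists l => /=; first exact: ltnSn.
by exists B => //; rewrite setTI.
Qed.

(** The events decided by finitely many inputs, coordinate by coordinate, form
    a generating family stable under intersection.  On it the product rule for
    independent inputs is the claim. *)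
Lemma past_indep l A B : input_filtration v l A -> measurable B ->
  P (A `&` v l @^-1` B) = P A * mu B.
Proof.
move=> FA mB.
pose C : set (set Omega) := [set A | exists E : nat -> set V,
  (forall i, measurable (E i)) /\ A = \bigcap_(i in `I_l) (v i @^-1` E i)].
have mv k (E : set V) : measurable E -> measurable (v k @^-1` E).
  by move=> mE; rewrite -[X in measurable X]setTI; exact: measurable_funP.
have CE : input_filtration v l `<=` <<s C >>.
  apply: sub_sigma_algebra2 => _ [k /= kl [E mE <-]].
  exists (fun i => if i == k then E else setT); split.
    by move=> i; case: ifP.
  rewrite setTI; apply/seteqP; split => w /=.
    by move=> Ew i /= il; case: ifPn => [/eqP ->|].
  by move=> /(_ k kl); rewrite eqxx.
have mC : C `<=` measurable.
  by move=> _ [E [mE ->]]; apply: bigcap_measurableType => i _; exact: mv.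
have CI : setI_closed C.
  move=> _ _ [E [mE ->]] [E' [mE' ->]]; exists (fun i => E i `&` E' i); split.
    by move=> i; exact: measurableI.
  by rewrite -bigcapI.
have CT : C setT.
  exists (fun=> setT); split => //.
  by apply/seteqP; split.
have mB' := mv l B mB.
have muB : mu B \is a fin_num by exact: fin_num_measure.
have muB0 : (0 <= fine (mu B))%R by exact: fine_ge0.
pose m1 : {measure set Omega -> \bar R} := mrestr P mB'.
pose m2 : {measure set Omega -> \bar R} := mscale (NngNum muB0) P.
have m1E D : m1 D = P (D `&` v l @^-1` B) by [].
have m2E D : m2 D = mu B * P D by rewrite -[in RHS](fineK muB).
suff : m1 A = m2 A by rewrite m1E m2E muleC.
apply: (@g_sigma_algebra_measure_unique _ R Omega C mC (fun=> setT)) => //.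
  - by rewrite bigcup_const.
  - move=> _ [E [mE ->]]; rewrite m1E m2E.
    pose J : {fset nat} := [fset i in iota 0 l]%fset.
    have JE : [set` J] = `I_l.
      by apply/seteqP; split => i /=; rewrite !inE/= mem_iota.
    have lJ : l \notin J by rewrite !inE/= mem_iota add0n ltnn.
    pose E' i := if i == l then B else E i.
    have mE' i : measurable (E' i) by rewrite /E'; case: ifP.
    have E'E i : (i < l)%N -> E' i = E i.
      by move=> il; rewrite /E' ltn_eqF.
    have [dist indep] := iid.
    have H1 := indep J E' mE'; have H2 := indep (l |` J)%fset E' mE'.
    rewrite big_fsetU1//= -H1 JE in H2.
    have -> : \bigcap_(i in `I_l) v i @^-1` E i = \bigcap_(i in `I_l) v i @^-1` E' i.
      by apply: eq_bigcapr => i il; rewrite E'E.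
    rewrite -(dist l B mB) -[distribution _ _ _]/(P (v l @^-1` B)).
    have -> : B = E' l by rewrite /E' eqxx.
    rewrite -H2; congr (P _).
    apply/seteqP; split => w /=.
      move=> [H lw] i; rewrite /= !inE => /orP[/eqP ->//|]; rewrite /= mem_iota => il.
      exact: H.
    move=> H; split; last by apply: H; rewrite /= !inE eqxx.
    by move=> i /= il; apply: H; rewrite /= !inE/= mem_iota il orbT.
  - by move=> k; rewrite m1E setTI -ge0_fin_numE// fin_num_measure.
  - exact: CE.
Qed.

End InputFiltration.

Section JumpProcess.
Local Open Scope ereal_scope.
Context {R : realType} {d} {Omega : measurableType d} (P : probability Omega R).
Context {dV} {V : measurableType dV} (mu : probability V R).
Context (v : nat -> {mfun Omega >-> V}).
Hypothesis iid : iid_inputs P mu v.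
Context (I : finType) (Z : nat -> I -> Omega -> \bar R) (g : I -> V -> R) (u0 : R).
Hypothesis Z_ge0 : forall l q w, 0 <= Z l q w.
Hypothesis Z_meas : forall l q, measurable_fun [set: past v l] (Z l q : past v l -> \bar R).
Hypothesis g_ge0 : forall q b, (0 <= g q b)%R.
Hypothesis g_meas : forall q, measurable_fun [set: V] (g q).
Hypothesis u0_ge0 : (0 <= u0)%R.

Definition jump_mean q : \bar R := \int[mu]_b (g q b)%:E.

(** The input [v l] draws one of the weighted values [Z l q], which are known
    beforehand.  A draw whose mean would exceed the current value is replaced
    by 0, which makes the process a supermartingale whatever [Z] is. *)
Fixpoint jump_process l : Omega -> \bar R :=
  if l is l'.+1 then fun w =>
    if \sum_q Z l' q w * jump_mean q <= jump_process l' w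
    then \sum_q Z l' q w * (g q (v l' w))%:E else 0
  else fun=> u0%:E.

Lemma jump_process_ge0 l w : 0 <= jump_process l w.
Proof.
case: l => [|l] /=; first by rewrite lee_fin.
case: ifP => // _; apply: sume_ge0 => q _; apply: mule_ge0 => //.
by rewrite lee_fin.
Qed.

Lemma measurable_past_mono l (f : Omega -> \bar R) :
  measurable_fun [set: past v l] (f : past v l -> \bar R) ->
  measurable_fun [set: past v l.+1] (f : past v l.+1 -> \bar R).
Proof. by move=> mf _ B mB; apply: input_filtration_mono; exact: mf. Qed.

Lemma measurable_past_ambient l (f : Omega -> \bar R) :
  measurable_fun [set: past v l] (f : past v l -> \bar R) ->
  measurable_fun [set: Omega] f.
Proof. by move=> mf _ B mB; apply: (@input_filtration_measurable _ _ _ _ v l); exact: mf. Qed.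

Lemma measurable_past_input l : measurable_fun [set: past v l.+1] (v l : past v l.+1 -> V).
Proof. by move=> _ B mB; rewrite setTI; exact: input_filtration_input. Qed.

Lemma measurable_jump_process l :
  measurable_fun [set: past v l] (jump_process l : past v l -> \bar R).
Proof.
elim: l => [|l IH]; first exact: measurable_cst.
apply: measurable_fun_ifT.
- apply: measurable_fun_lee; last exact: measurable_past_mono.
  apply: emeasurable_sum => q; apply: emeasurable_funM; last exact: measurable_cst.
  by apply: measurable_past_mono; exact: Z_meas.
- apply: emeasurable_sum => q; apply: emeasurable_funM.
    by apply: measurable_past_mono; exact: Z_meas.
  apply/measurable_EFinP; apply: measurableT_comp; first exact: g_meas.
  exact: measurable_past_input.
- exact: measurable_cst.
Qed.

(** The value [Z l q] is fixed by the past, so integrating the next input out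
    leaves the mean that the recursion has capped. *)
Lemma jump_process_super l A : input_filtration v l A ->
  \int[P]_(w in A) jump_process l.+1 w <= \int[P]_(w in A) jump_process l w.
Proof.
move=> FA.
have mid : measurable_fun [set: Omega] (fun w => w : past v l).
  by move=> _ B mB; rewrite setTI; exact: (@input_filtration_measurable _ _ _ _ v l B mB).
pose pi : {mfun Omega >-> past v l} :=
  HB.pack (fun w => w : past v l) (isMeasurableFun.Build _ _ _ _ _ mid).
pose ok (w : past v l) := \sum_q Z l q w * jump_mean q <= jump_process l w.
have mok : measurable_fun [set: past v l] ok.
  apply: measurable_fun_lee; last exact: measurable_jump_process.
  apply: emeasurable_sum => q; apply: emeasurable_funM; first exact: Z_meas.
  exact: measurable_cst.
have mA : measurable (A : set (past v l)) by exact: FA.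
pose f (z : past v l * V) := if (z.1 \in A) && ok z.1
  then \sum_q Z l q z.1 * (g q z.2)%:E else 0.
have mf : measurable_fun setT f.
  apply: measurable_fun_ifT.
  - apply: measurable_and.
      have mem_meas : measurable_fun [set: past v l] (fun w => w \in A).
        by apply: (measurable_fun_bool true); rewrite setTI preimage_mem_true.
      exact: (measurableT_comp mem_meas).
    exact: (measurableT_comp mok).
  - apply: emeasurable_sum => q; apply: emeasurable_funM.
      exact: (measurableT_comp (@Z_meas l q) measurable_fst).
    by apply/measurable_EFinP; exact: (measurableT_comp (g_meas q) measurable_snd).
  - exact: measurable_cst.
have f0 z : 0 <= f z.
  rewrite /f; case: ifP => // _; apply: sume_ge0 => q _; apply: mule_ge0 => //.
  by rewrite lee_fin.
have indep B C : measurable B -> measurable C ->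
    P (pi @^-1` B `&` v l @^-1` C) = P (pi @^-1` B) * mu C.
  by move=> mB mC; exact: past_indep.
have := integral_independent indep mf f0.
have -> : \int[P]_w f (pi w, v l w) = \int[P]_(w in A) jump_process l.+1 w.
  rewrite [RHS]integral_mkcond; apply: eq_integral => w _.
  by rewrite patchE /f /=; case: (w \in A).
move=> ->; rewrite [leRHS]integral_mkcond; apply: ge0_le_integral => //.
- by move=> w _; exact: integral_ge0.
- have mF := @measurable_fun_fubini_tonelli_F _ _ _ _ _ mu f mf f0.
  exact: (@measurable_past_ambient l _ mF).
- apply/(measurable_restrictT _ (input_filtration_measurable FA)).
  apply: measurable_funTS; exact: (measurable_past_ambient (@measurable_jump_process l)).
move=> w _; rewrite patchE /f /=; case: (w \in A) => /=; last first.
  by rewrite integral0.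
case okw : (ok w); last by rewrite integral0 jump_process_ge0.
apply: le_trans okw; rewrite ge0_integral_sum//; last 2 first.
- move=> q; apply: emeasurable_funM; first exact: measurable_cst.
  exact/measurable_EFinP.
- by move=> q b _; rewrite mule_ge0// lee_fin.
apply: lee_sum => q _; rewrite ge0_integralZl//.
  exact/measurable_EFinP.
by move=> b _; rewrite lee_fin.
Qed.

Lemma jump_process_ville (K : R) : (0 <= K)%R ->
  K%:E * P (\bigcup_l [set w | K%:E <= jump_process l w]) <= u0%:E.
Proof.
move=> K0.
have lev l : input_filtration v l [set w | K%:E <= jump_process l w].
  have := @measurable_jump_process l measurableT _ (emeasurable_itv `[K%:E, +oo[%O).
  rewrite setTI; congr (input_filtration v l _); apply/seteqP.
  by split => w /=; rewrite in_itv/= andbT.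
have := @ville _ _ _ P (input_filtration v) jump_process K.
rewrite [X in _ <= X](_ : _ = u0%:E); last first.
  rewrite (_ : jump_process 0 = cst u0%:E)// integral_cst//.
  by rewrite -[RHS]mule1; congr (_ * _); exact: probability_setT.
apply => //.
- exact: input_filtration_measurable.
- exact: input_filtration_mono.
- by move=> l; exact: (@measurableT _ (past v l)).
- by move=> l A B; exact: (@measurableI _ (past v l)).
- by move=> l A; exact: (@measurableC _ (past v l)).
- exact: jump_process_ge0.
- by move=> l; exact: (measurable_past_ambient (@measurable_jump_process l)).
- exact: jump_process_super.
Qed.

End JumpProcess.

(** * Mean value of the Lyapunov factor under the input law *)

Section JumpWeights.
Context {R : realType}.

(** The truncation at 0 only matters outside the support of the timer law; it
    keeps the weight nonnegative and continuous on the whole line. *)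
Definition timer_weight (c u : R) : R := (1 + c * Num.max 0 u)^-1.

Lemma timer_weight_ge0 c u : 0 <= c -> 0 <= timer_weight c u.
Proof.
by move=> c0; rewrite invr_ge0 addr_ge0// mulr_ge0// le_max lexx.
Qed.

Lemma continuous_timer_weight (c : R) : 0 <= c -> continuous (timer_weight c).
Proof.
move=> c0 u; apply: cvgV.
  by rewrite gt_eqF// ltr_pwDl// mulr_ge0// le_max lexx.
apply: cvgD; first exact: cvg_cst.
apply: cvgM; first exact: cvg_cst.
by apply: continuous_max; [exact: cvg_cst | exact: cvg_id].
Qed.

Lemma measurable_timer_weight (c : R) : 0 <= c ->
  measurable_fun [set: R] (timer_weight c).
Proof.
by move=> c0; apply: continuous_measurable_fun; exact: continuous_timer_weight.
Qed.

Lemma integral_timer_weight (c T : R) (T0 : 0 < T) : 0 < c ->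
  (\int[uniform_prob T0]_u (timer_weight c u)%:E =
   ((c * T)^-1 * ln (1 + c * T))%:E)%E.
Proof.
move=> c0; have c0' := ltW c0; rewrite integral_uniform; last 2 first.
- by apply/measurable_EFinP; exact: measurable_timer_weight.
- by move=> u; rewrite lee_fin timer_weight_ge0.
pose F (u : R) := c^-1 * ln (1 + c * u).
have dF (u : R) : 0 <= u -> is_derive u 1 F (1 + c * u)^-1.
  move=> u0; have p0 : 0 < 1 + c * u by rewrite ltr_pwDl// mulr_ge0.
  have dl : is_derive u 1 (fun x : R => 1 + c * x) c.
    have := is_deriveD (is_derive_cst (1 : R) u (1 : R))
      (is_deriveM (is_derive_cst c u (1 : R)) (is_derive_id u (1 : R))) => h.
    by apply: is_derive_eq h _; rewrite scaler0 addr0 add0r /GRing.scale/= mulr1.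
  have := is_deriveM (is_derive_cst c^-1 u (1 : R))
    (@is_derive1_comp R (@ln R) (fun x : R => 1 + c * x) u _ _ (is_derive1_ln p0) dl) => h.
  apply: is_derive_eq h _; rewrite scaler0 addr0 /GRing.scale/=.
  by rewrite mulrCA mulVf ?mulr1// gt_eqF.
have cF (u : R) : 0 <= u -> {for u, continuous F}.
  by move=> /dF[d _]; apply: differentiable_continuous; apply/derivable1_diffP.
rewrite (@continuous_FTC2 _ _ F)//.
- by rewrite /F mulr0 addr0 ln1 mulr0 subr0 sube0 -EFinM mulrA invfM [T^-1 * _]mulrC.
- by apply: continuous_subspaceT; exact: continuous_timer_weight.
- split.
  + by move=> u; rewrite in_itv/= => /andP[/ltW/dF[]].
  + by apply: cvg_at_right_filter; exact: cF.
  + by apply: cvg_at_left_filter; apply: cF; exact: ltW.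
- move=> u; rewrite in_itv/= => /andP[/ltW u0 _]; have du := dF u u0.
  by rewrite derive1E derive_val /timer_weight max_r.
Qed.

Context {N : nat} (lambda : 'I_N -> R) (lambda_ge0 : forall q, 0 <= lambda q)
  (lambda_sum1 : \sum_(q < N) lambda q = 1).

Lemma mode_law_mode (q : 'I_N) : mode_law lambda_ge0 lambda_sum1 [set q.+1%:R] = (lambda q)%:E.
Proof.
rewrite /mode_law (bigD1 q)//= diracE mem_set// mule1 big1 ?adde0// => i iq.
rewrite diracE memNset ?mule0// => /= /eqP.
by rewrite eqr_nat eqSS => /eqP/val_inj/esym/eqP; rewrite eq_sym (negbTE iq).
Qed.

Definition jump_weight (c : R) (q : 'I_N) (b : measurableTypeR R * measurableTypeR R) : R :=
  \1_[set q.+1%:R] b.1 * timer_weight c b.2.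

Lemma jump_weight_ge0 c q b : 0 <= c -> 0 <= jump_weight c q b.
Proof. by move=> c0; rewrite mulr_ge0// timer_weight_ge0. Qed.

Lemma measurable_jump_weight (c : R) q : 0 <= c ->
  measurable_fun [set: measurableTypeR R * measurableTypeR R] (jump_weight c q).
Proof.
move=> c0; apply: measurable_funM.
  have mi : measurable_fun [set: measurableTypeR R] (\1_[set q.+1%:R] : _ -> R).
    by apply: measurable_indic; exact: measurable_set1.
  exact: (measurableT_comp mi measurable_fst).
exact: (measurableT_comp (@measurable_timer_weight c c0) measurable_snd).
Qed.

Lemma integral_jump_weight (c T : R) (T0 : 0 < T) q : 0 < c ->
  (\int[sw_input_law lambda_ge0 lambda_sum1 T0]_b (jump_weight c q b)%:E =
   (lambda q * ((c * T)^-1 * ln (1 + c * T)))%:E)%E.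
Proof.
move=> c0; have c0' := ltW c0.
rewrite /sw_input_law fubini_tonelli1; last 2 first.
- by apply/measurable_EFinP; exact: measurable_jump_weight.
- by move=> b; rewrite lee_fin jump_weight_ge0.
rewrite /fubini_F /jump_weight/=.
under eq_integral => x _.
  under eq_integral do rewrite EFinM.
  rewrite ge0_integralZl//; last 2 first.
  - by apply/measurable_EFinP; exact: measurable_timer_weight.
  - by move=> u _; rewrite lee_fin timer_weight_ge0.
  rewrite integral_timer_weight// muleC.
  over.
rewrite ge0_integralZl//; last 2 first.
- by apply/measurable_EFinP; apply: measurable_indic; exact: measurable_set1.
- by rewrite lee_fin mulr_ge0// ?invr_ge0 ?mulr_ge0 ?ln_ge0 ?lerDl ?mulr_ge0// ltW.
rewrite integral_indic//= setIT mode_law_mode -EFinM; congr EFin; ring.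
Qed.

End JumpWeights.

(** * Uniform asymptotic stability in probability *)

Section LyapunovBounds.
Context {R : realType} {N n n2 : nat}.
Local Notation state := 'cV[R]_(n + (1 + (1 + n2))).
Context (G : 'M[R]_(n2, n)) (P : 'I_N -> 'M[R]_n) (Pz : 'M[R]_n2) (T c : R).
Hypotheses (P_pos : forall q, posdefmx (P q)) (Pz_pos : posdefmx Pz)
  (T_ge0 : 0 <= T) (c_ge0 : 0 <= c).

Definition slow_fast_sqnorm (s : state) : R := sqnorm (st_xi s) + sqnorm (st_z s).

Lemma slow_fast_sqnorm_ge0 s : 0 <= slow_fast_sqnorm s.
Proof. by rewrite addr_ge0// sqnorm_ge0. Qed.

Lemma sqnormD_le m (x y : 'cV[R]_m) : sqnorm (x + y) <= 2 * (sqnorm x + sqnorm y).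
Proof.
rewrite /sqnorm -big_split/= mulr_sumr; apply: ler_sum => i _; rewrite mxE.
have := sqr_ge0 (x i 0 - y i 0); rewrite sqrrB sqrrD; lra.
Qed.

Lemma sqnormN m (x : 'cV[R]_m) : sqnorm (- x) = sqnorm x.
Proof. by apply: eq_bigr => i _; rewrite mxE sqrrN. Qed.

(** The change of variables from [z] to [w = z + G xi] is invertible, and the
    timer factor stays between 1 / (1 + c T) and 1. *)
Lemma lyap_bounds : exists2 lo, 0 < lo & exists2 hi, 0 < hi &
  forall q s, in_mode T q s ->
    lo * slow_fast_sqnorm s <= lyap G P Pz c q s <= hi * slow_fast_sqnorm s.
Proof.
have [Gk Gk0 HG] := sqnorm_mul_bound G.
have [b b0 Hb] := posdefmx_coercive Pz_pos; have [Kz Kz0 HKz] := qform_upper Pz.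
(* The lower constant [r] serves the boundary-layer form and all the [P q]. *)
have [r r0 Hr] : exists2 r, 0 < r & forall a, 0 < a <= r ->
    forall q xi, a * sqnorm xi <= bform (P q) xi xi.
  apply: (small_uniform (P := fun q a => forall xi, a * sqnorm xi <= bform (P q) xi xi)).
  move=> q; have [a a0 Ha] := posdefmx_coercive (P_pos q); exists a => // a' /andP[_ aa'] xi.
  by apply: le_trans (Ha xi); rewrite ler_wpM2r ?sqnorm_ge0.
pose K := \sum_q sval (cid2 (qform_upper (P q))).
have HK q xi : bform (P q) xi xi <= K * sqnorm xi.
  have K0 i : 0 <= sval (cid2 (qform_upper (P i))) by case: cid2.
  apply: (@le_trans _ _ (sval (cid2 (qform_upper (P q))) * sqnorm xi)).
    by case: cid2.
  rewrite ler_wpM2r ?sqnorm_ge0// /K (bigD1 q)//= lerDl.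
  by apply: sumr_ge0 => i _; exact: K0.
have K0 : 0 <= K by apply: sumr_ge0 => i _; case: cid2.
pose mu := Num.min r b; have mu0 : 0 < mu by rewrite lt_min r0 b0.
pose lo := mu / (2 * (Gk + 1)) / (1 + c * T).
pose hi := K + 2 * Kz * (Gk + 1) + 1.
have cT : 0 < 1 + c * T by rewrite ltr_pwDl// mulr_ge0.
have Gk1 : 0 < Gk + 1 by rewrite ltr_wpDl.
exists lo; first by rewrite !divr_gt0// mulr_gt0.
exists hi; first by rewrite ltr_wpDl// addr_ge0 ?mulr_ge0// ltW.
move=> q s [_ /andP[t0 tT]].
have h1 : 1 <= 1 + c * st_tau s by rewrite lerDl mulr_ge0.
have h2 : 1 + c * st_tau s <= 1 + c * T by rewrite lerD2l ler_wpM2l.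
have h0 : 0 < 1 + c * st_tau s by lra.
set x := sqnorm (st_xi s); set z := sqnorm (st_z s); set w := sqnorm (st_w G s).
have x0 : 0 <= x := sqnorm_ge0 _; have z0 : 0 <= z := sqnorm_ge0 _.
have w0 : 0 <= w := sqnorm_ge0 _.
have gx : sqnorm (G *m st_xi s) <= Gk * x by exact: HG.
have wz : w <= 2 * (z + Gk * x).
  apply: (le_trans (sqnormD_le _ _)); rewrite ler_pM2l//.
  by rewrite lerD2l.
have zw : z <= 2 * (w + Gk * x).
  have -> : z = sqnorm (st_w G s + - (G *m st_xi s)) by rewrite /st_w addrK.
  by apply: (le_trans (sqnormD_le _ _)); rewrite ler_pM2l// sqnormN lerD2l.
have xi_lo : mu * x <= bform (P q) (st_xi s) (st_xi s).
  by apply: Hr; rewrite mu0 ge_min lexx.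
have w_lo : mu * w <= bform Pz (st_w G s) (st_w G s).
  by apply: le_trans (Hb _); rewrite ler_wpM2r// ge_min lexx orbT.
have xi_hi : bform (P q) (st_xi s) (st_xi s) <= K * x := HK q _.
have w_hi : bform Pz (st_w G s) (st_w G s) <= Kz * w := HKz _.
have E0 : 0 <= energy G P Pz q s by exact: energy_ge0.
rewrite /lyap; apply/andP; split.
  rewrite /lo mulrAC ler_pdivrMr//.
  have e1 : mu / (2 * (Gk + 1)) * slow_fast_sqnorm s <= energy G P Pz q s.
    rewrite mulrAC ler_pdivrMr ?mulr_gt0//.
    apply: (@le_trans _ _ ((mu * x + mu * w) * (2 * (Gk + 1)))); last first.
      by rewrite ler_pM2r ?mulr_gt0// lerD.
    rewrite /slow_fast_sqnorm -/x -/z -mulrDr -!mulrA ler_pM2l//.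
    have : 0 <= Gk * w by rewrite mulr_ge0.
    lra.
  apply: (le_trans e1); rewrite mulrAC ler_pdivlMr// ler_wpM2l//.
rewrite ler_pdivrMr//.
apply: (@le_trans _ _ (hi * slow_fast_sqnorm s)); last first.
  rewrite ler_peMr// mulr_ge0 ?slow_fast_sqnorm_ge0// /hi.
  by rewrite !addr_ge0 ?mulr_ge0// ltW.
rewrite /energy /slow_fast_sqnorm -/x -/z.
have e2 : Kz * w <= Kz * (2 * (z + Gk * x)) by rewrite ler_wpM2l.
have p1 : 0 <= Kz * x by rewrite mulr_ge0.
have p2 : 0 <= Kz * Gk * z by rewrite !mulr_ge0.
have p3 : 0 <= K * z by rewrite mulr_ge0.
by rewrite /hi; lra.
Qed.

Lemma st_xi_sub (y s : state) : st_xi (y - s) = st_xi y - st_xi s.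
Proof. by rewrite /st_xi linearB. Qed.

Lemma st_z_sub (y s : state) : st_z (y - s) = st_z y - st_z s.
Proof. by rewrite /st_z !linearB. Qed.

Lemma st_q_sub (y s : state) : st_q (y - s) = st_q y - st_q s.
Proof. by rewrite /st_q !mxE. Qed.

Lemma st_tau_sub (y s : state) : st_tau (y - s) = st_tau y - st_tau s.
Proof. by rewrite /st_tau !mxE. Qed.

Lemma enorm_sq m (x : 'cV[R]_m) : enorm x ^+ 2 = sqnorm x.
Proof. by rewrite sqr_sqrtr// sqnorm_ge0. Qed.

Lemma sqnorm_state (s : state) :
  sqnorm s = slow_fast_sqnorm s + st_q s ^+ 2 + st_tau s ^+ 2.
Proof.
rewrite /slow_fast_sqnorm /sqnorm !big_split_ord/= !big_ord1.
rewrite /st_xi /st_z /st_q /st_tau.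
under [X in _ = X + _ + _ + _]eq_bigr do rewrite mxE.
under [X in _ = _ + X + _ + _]eq_bigr do rewrite !mxE.
by rewrite !mxE; ring.
Qed.

Lemma edist_target_ge (y : state) (i0 : 'I_N) :
  Num.sqrt (slow_fast_sqnorm y) <= Defs.edist y (sw_target (N := N) T).
Proof.
apply: lb_le_inf.
  pose s0 : state := col_mx 0 (col_mx (const_mx i0.+1%:R) 0).
  exists (enorm (y - s0)); exists s0 => //; split.
  - by rewrite /st_xi col_mxKu.
  - by exists i0; rewrite /is_mode /st_q col_mxKd col_mxKu mxE.
  - by rewrite /st_tau !col_mxKd; rewrite -[0]row_mx0 || rewrite !mxE lexx.
  - by rewrite /st_z !col_mxKd linear0.
move=> _ [s [xs _ _ zs] <-]; rewrite /enorm ler_wsqrtr// -/(sqnorm (y - s)).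
rewrite sqnorm_state /slow_fast_sqnorm st_xi_sub st_z_sub xs zs !subr0.
by rewrite -addrA lerDl addr_ge0 ?sqr_ge0.
Qed.

Lemma inflate_target (q : 'I_N) (y : state) (e : R) : 0 < e -> in_mode T q y ->
  slow_fast_sqnorm y < e ^+ 2 -> inflate (sw_target (N := N) T) e y.
Proof.
move=> e0 [mq tT] small; rewrite inflateE//=.
pose s : state := col_mx 0 (col_mx (const_mx (st_q y)) (col_mx (const_mx (st_tau y)) 0)).
have xs : st_xi s = 0 by rewrite /st_xi col_mxKu.
have qs : st_q s = st_q y by rewrite {1}/st_q col_mxKd col_mxKu mxE.
have ts : st_tau s = st_tau y by rewrite {1}/st_tau !col_mxKd col_mxKu mxE.
have zs : st_z s = 0 by rewrite /st_z !col_mxKd.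
exists s; first by split; rewrite ?qs ?ts//; exists q.
have q0 : st_q (y - s) = 0 by rewrite st_q_sub qs subrr.
have t0 : st_tau (y - s) = 0 by rewrite st_tau_sub ts subrr.
rewrite -(ltr_pXn2r (n := 2))// ?nnegrE ?sqrtr_ge0 ?ltW// enorm_sq sqnorm_state.
rewrite q0 t0 expr0n/= !addr0.
by rewrite /slow_fast_sqnorm st_xi_sub st_z_sub xs zs !subr0.
Qed.

Lemma continuous_bform_comp m k (V : topologicalType) (M : 'M[R]_(m, k))
    (f : V -> 'cV[R]_m) (g : V -> 'cV[R]_k) :
  (forall i, continuous (fun x => f x i 0)) -> (forall i, continuous (fun x => g x i 0)) ->
  continuous (fun x => bform M (f x) (g x)).
Proof.
move=> cf cg; under eq_fun do rewrite bformE.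
apply: continuous_finsum => i; apply: continuous_finsum => j x.
apply: cvgM; last exact: cg.
by apply: cvgM; [exact: cf | exact: cvg_cst].
Qed.

Lemma continuous_energy q : continuous (energy G P Pz q).
Proof.
have cxi i : continuous (fun s : state => st_xi s i 0).
  by under eq_fun do rewrite /st_xi mxE; exact: coord_continuous.
have cz i : continuous (fun s : state => st_z s i 0).
  by under eq_fun do rewrite /st_z !mxE; exact: coord_continuous.
have cw i : continuous (fun s : state => st_w G s i 0).
  have -> : (fun s : state => st_w G s i 0) =
      (fun s => st_z s i 0 + \sum_j G i j * st_xi s j 0).
    by apply/funext => s; rewrite [LHS]mxE; congr (_ + _); rewrite mxE.
  have csum : continuous (fun s : state => \sum_j G i j * st_xi s j 0).
    apply: continuous_finsum => j s.
    exact: (@cvgM _ _ (nbhs s) _ (fun=> G i j) (fun s => st_xi s j 0) _ _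
      (cvg_cst _) (cxi j s)).
  by move=> s; exact: (@cvgD _ _ _ (nbhs s) _ _ _ _ _ (cz i s) (csum s)).
have c1 := @continuous_bform_comp _ _ _ (P q) _ _ cxi cxi.
have c2 := @continuous_bform_comp _ _ _ Pz _ _ cw cw.
by move=> s; exact: (@cvgD _ _ _ (nbhs s) _ _ _ _ _ (c1 s) (c2 s)).
Qed.

End LyapunovBounds.

Section ExcursionBound.
Context {R : realType} {N n n2 : nat}.
Local Notation state := 'cV[R]_(n + (1 + (1 + n2))).
Context (G : 'M[R]_(n2, n)) (Pm : 'I_N -> 'M[R]_n) (Pz : 'M[R]_n2).
Context (T eta eps c a : R) (At : 'I_N -> 'M[R]_n) (B : 'I_N -> 'M[R]_(n, n2))
  (H : 'M[R]_(n2, n)) (L : 'M[R]_n2).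
Context (lambda : 'I_N -> R) (lambda_ge0 : forall q, 0 <= lambda q)
  (lambda_sum1 : \sum_(q < N) lambda q = 1) (T_gt0 : 0 < T).
Hypotheses (eps_gt0 : 0 < eps) (c_gt0 : 0 < c) (a_gt0 : 0 < a).
Hypotheses (P_pos : forall q, posdefmx (Pm q)) (Pz_pos : posdefmx Pz).
Hypothesis LG : L *m G = H.
Hypothesis rate : forall q xi w,
  let xi' := (At q - B q *m G) *m xi + B q *m w in
  2 * bform (Pm q) xi xi' + 2 * bform Pz w (eps^-1 *: (L *m w) + G *m xi')
  + (a + c * eta) * (bform (Pm q) xi xi + bform Pz w w) <= 0.

Let kappa := (c * T)^-1 * ln (1 + c * T).
Hypothesis jump_decay : forall q (s : state),
  expR a * kappa * (\sum_i lambda i * energy G Pm Pz i s) <= energy G Pm Pz q s.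

Local Notation sys := (switched_shs eta eps At B H L lambda_ge0 lambda_sum1 T_gt0).
Local Notation inputs := (measurableTypeR R * measurableTypeR R)%type.
Local Notation law := (sw_input_law lambda_ge0 lambda_sum1 T_gt0).

Context {d} {Omega : measurableType d} (P : probability Omega R)
  (v : nat -> {mfun Omega >-> inputs}).
Hypothesis iid : iid_inputs P law v.
Context (y0 : state) (y : Omega -> hybrid_arc R (n + (1 + (1 + n2)))) (q0 : 'I_N).
Hypothesis y0_mode : in_mode T q0 y0.
Hypothesis sol : random_solution sys v y0 y.

Let c_ge0 : 0 <= c := ltW c_gt0.
Let V q s := lyap G Pm Pz c q s.

(** The discounted value that a jump out of level [l] into mode [q] would
    give, apart from the factor that depends on the new timer. *)
Definition jump_candidate (l : nat) (q : 'I_N) (p : R * state) : R :=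
  expR (a * (p.1 + l.+1%:R)) * energy G Pm Pz q p.2.

Lemma continuous_jump_candidate l q : continuous (jump_candidate l q).
Proof.
move=> p.
have h1 : (fun p : R * state => expR (a * (p.1 + l.+1%:R))) @ p -->
    expR (a * (p.1 + l.+1%:R)).
  apply: (@continuous_comp _ _ _ (fun p : R * state => a * (p.1 + l.+1%:R)) expR).
    apply: (@cvgM _ _ (nbhs p) _ (fun=> a)); first exact: cvg_cst.
    by apply: (@cvgD _ _ _ (nbhs p)); [exact: cvg_fst | exact: cvg_cst].
  exact: continuous_expR.
have h2 : (fun p : R * state => energy G Pm Pz q p.2) @ p --> energy G Pm Pz q p.2.
  apply: (@continuous_comp _ _ _ snd (energy G Pm Pz q)); first exact: cvg_snd.
  exact: continuous_energy.
exact: (cvgM h1 h2).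
Qed.

Lemma jump_candidate_ge0 l q p : 0 <= jump_candidate l q p.
Proof. by rewrite mulr_ge0 ?expR_ge0// energy_ge0. Qed.

Definition weighted_end l q (w : Omega) : \bar R :=
  endpoint_value (fun w => graph_upto l (y w)) l (jump_candidate l q) w.

Lemma weighted_end_ge0 l q w : (0 <= weighted_end l q w)%E.
Proof.
apply: le_ereal_inf_tmp => _ [x [r [[p [Gp pl rp]] nex]] <-]; rewrite lee_fin leNgt.
apply/negP => x0; apply: nex; exists p; split => //.
exact: lt_le_trans (jump_candidate_ge0 _ _ _).
Qed.

Lemma measurable_weighted_end l q :
  measurable_fun [set: past v l] (weighted_end l q : past v l -> \bar R).
Proof.
have [[_ adap] _ _ _] := sol.
exact: (@measurable_endpoint_value _ _ _ (past v l) _ l _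
  (@continuous_jump_candidate l q) (adap l)).
Qed.

Definition discounted_lyap : nat -> Omega -> \bar R :=
  jump_process (I := 'I_N) law v weighted_end (@jump_weight R N c) (V q0 y0).

Definition good_input : set inputs :=
  [set b | (exists q : 'I_N, is_mode b.1 q) /\ 0 <= b.2 <= T].

(** An input outside [good_input] can send the state outside the flow and jump
    sets, where the Lyapunov function carries no information. *)
Definition good_inputs : set Omega := [set w | forall l, good_input (v l w)].

Lemma jump_weight_good (q' : 'I_N) (b : inputs) (q : 'I_N) : is_mode b.1 q -> 0 <= b.2 <= T ->
  jump_weight c q' b = if q' == q then (1 + c * b.2)^-1 else 0.
Proof.
move=> mq /andP[b0 _]; rewrite /jump_weight /timer_weight max_r//.
have [->|qq] := eqVneq q' q; first by rewrite indicE mem_set ?mul1r.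
rewrite indicE memNset ?mul0r// => /= mq'.
by move/eqP: qq; apply; exact: is_mode_inj mq' mq.
Qed.

Lemma flow_on_level w j s1 s2 : s1 <= s2 ->
  (forall u, s1 <= u -> u <= s2 -> arc_dom (y w) (u, j)) ->
  abs_continuous (arc_val (y w) ^~ j) s1 s2 /\
  (s1 < s2 -> flows T eta eps At B H L (arc_val (y w) ^~ j) s1 s2).
Proof.
move=> s12 dom; split.
  apply: arc_valP => // u /=; rewrite in_itv/= => /andP[]; exact: dom.
move=> s12'; have [_ _ fl _] := sol.
by apply: (fl w s1 s2 j) => //; apply: dom.
Qed.

Lemma level_decay w j s1 s2 q : s1 <= s2 ->
  (forall u, s1 <= u -> u <= s2 -> arc_dom (y w) (u, j)) ->
  in_mode T q (arc_val (y w) s1 j) ->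
  in_mode T q (arc_val (y w) s2 j) /\
  expR (a * s2) * V q (arc_val (y w) s2 j) <= expR (a * s1) * V q (arc_val (y w) s1 j).
Proof.
move=> s12 dom m1; have [acy fl] := flow_on_level s12 dom.
move: s12; rewrite le_eqVlt => /orP[/eqP <-//|s12]; have s12' := ltW s12.
split; first by apply: (flow_in_mode acy (fl s12) m1); rewrite s12' lexx.
exact: (lyap_flow_decay eps_gt0 c_ge0 P_pos Pz_pos LG rate s12' acy (fl s12) m1).
Qed.

(** Along the solution no draw is ever replaced by 0: at the end of a level the
    timer is 0, so [jump_decay] bounds the mean of the draw by the discounted
    Lyapunov function there, hence, by decay along the flow, by its
    value at the start of the level. *)
Lemma discounted_lyap_start w (t : nat -> R) : good_inputs w ->
  jump_times (arc_dom (y w)) t ->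
  forall l, arc_dom (y w) (t l, l) -> exists q, in_mode T q (arc_val (y w) (t l) l) /\
    discounted_lyap l w = (expR (a * (t l + l%:R)) * V q (arc_val (y w) (t l) l))%:E.
Proof.
move=> good jt; have [t0 tS level jump] := jt.
elim=> [|l IH] dom.
  have [_ init _ _] := sol; rewrite t0 init; exists q0; split => //.
  by rewrite addr0 mulr0 expR0 mul1r.
have [dome _ ub] := jump _ _ dom; have [tle lev] := level _ _ dome.
have [doml _] := level _ _ (lev _ (lexx _) tle).
have [q [mq Uq]] := IH (lev _ (lexx _) tle).
set e := t l.+1 in dom dome ub tle lev *.
have [me dec] := level_decay tle lev mq.
have [_ _ _ jc] := sol.
have [[_ tau0] [xi' qv tauv z']] := jc w e l dome dom.
have [[q' mq'] tv] := good l.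
have energy' i : energy G Pm Pz i (arc_val (y w) e l.+1) = energy G Pm Pz i (arc_val (y w) e l).
  by rewrite /energy /st_w xi' z'.
have ZE i : weighted_end l i w =
    (expR (a * (e + l.+1%:R)) * energy G Pm Pz i (arc_val (y w) e l))%:E.
  exact: (endpoint_value_jump (@continuous_jump_candidate l i) (leqnn l) _ jt dom).
exists q'; split; first by split; rewrite ?qv ?tauv.
have accept : (\sum_i weighted_end l i w * jump_mean law (jump_weight c) i
    <= discounted_lyap l w)%E.
  rewrite Uq; apply: (@le_trans _ _ (expR (a * (e + l%:R)) * V q (arc_val (y w) e l))%:E).
    under eq_bigr => i _ do rewrite ZE /jump_mean integral_jump_weight// -EFinM.
    rewrite sumEFin lee_fin /V /lyap tau0 mulr0 addr0 divr1.
    have -> : \sum_(i < N) expR (a * (e + l.+1%:R)) * energy G Pm Pz i (arc_val (y w) e l) *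
        (lambda i * ((c * T)^-1 * ln (1 + c * T))) =
      expR (a * (e + l%:R)) *
        (expR a * kappa * \sum_i lambda i * energy G Pm Pz i (arc_val (y w) e l)).
      rewrite -natr1 addrA mulrDr mulr1 expRD -/kappa !mulr_sumr.
      by apply: eq_bigr => i _; ring.
    by rewrite ler_pM2l ?expR_gt0//; exact: jump_decay.
  rewrite lee_fin !mulrDr !expRD !(mulrAC _ (expR (a * l%:R))).
  by rewrite ler_pM2r ?expR_gt0.
rewrite /discounted_lyap/= accept.
under eq_bigr => i _ do rewrite ZE (jump_weight_good _ mq' tv) -EFinM.
rewrite sumEFin (bigD1 q')//= eqxx big1 ?addr0; last first.
  by move=> i iq; rewrite (negbTE iq) mulr0.
by rewrite /V /lyap energy' tauv mulrA.
Qed.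

Lemma good_input_measurable : measurable good_input.
Proof.
have -> : good_input = (\bigcup_(q in [set: 'I_N]) [set q.+1%:R]) `*` `[0, T]%classic.
  apply/seteqP; split => b /=.
    by move=> [[q mq] bT]; split; [exists q | rewrite /= in_itv].
  by move=> [[q _ mq] bT]; split; [exists q | move: bT; rewrite /= in_itv].
by apply: measurableX => //; exact: fin_bigcup_measurable.
Qed.

Lemma good_input_ae : law good_input = 1%E.
Proof.
have -> : good_input = (\bigcup_(q in [set: 'I_N]) [set q.+1%:R]) `*` `[0, T]%classic.
  apply/seteqP; split => b /=.
    by move=> [[q mq] bT]; split; [exists q | rewrite /= in_itv].
  by move=> [[q _ mq] bT]; split; [exists q | move: bT; rewrite /= in_itv].
have mM : measurable (\bigcup_(q in [set: 'I_N]) [set q.+1%:R] : set (measurableTypeR R)).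
  by apply: fin_bigcup_measurable.
rewrite /sw_input_law/= product_measure1E//.
rewrite [X in (_ * X)%E](_ : _ = 1%E); last exact: integral_uniform_pdf1.
rewrite mule1; transitivity (\sum_q lambda q)%:E; last by rewrite lambda_sum1.
rewrite -sumEFin; apply: eq_bigr => q _.
by rewrite diracE mem_set ?mule1//; exists q.
Qed.

Lemma good_inputs_ae : measurable (~` good_inputs) /\ P (~` good_inputs) = 0%E.
Proof.
have mbad l : measurable (v l @^-1` (~` good_input)).
  rewrite -[X in measurable X]setTI; apply: measurable_funP => //.
  by apply: measurableC; exact: good_input_measurable.
have -> : ~` good_inputs = \bigcup_l (v l @^-1` (~` good_input)).
  apply/seteqP; split => w /=.
    by move=> /existsNP[l hl]; exists l.
  by move=> [l _ hl] good; apply: hl; exact: good.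
split; first exact: bigcupT_measurable.
apply: measure_negligible; first exact: bigcupT_measurable.
apply: negligible_bigcup => l; apply/negligibleP; first exact: mbad.
have [dist _] := iid.
suff : distribution P (v l) (~` good_input) = 0%E by [].
rewrite dist; last by apply: measurableC; exact: good_input_measurable.
rewrite (probability_setC law); last exact: good_input_measurable.
by rewrite good_input_ae subee.
Qed.

Context (lo : R) (lo_gt0 : 0 < lo).
Hypothesis lo_bound : forall q s, in_mode T q s ->
  lo * slow_fast_sqnorm s <= lyap G Pm Pz c q s.

Definition excursion (e Tbar : R) : set Omega :=
  [set w | exists p, graph (y w) p /\
     (Tbar <= p.1.1 + p.1.2%:R /\ ~ inflate (sw_target (N := N) T) e p.2)].

Lemma measurable_excursion e Tbar : 0 < e -> measurable (excursion e Tbar).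
Proof.
move=> e0; have [[[cl ms] _] _ _ _] := sol.
apply: (measurable_closed_hit ms cl (K := fun j =>
  [set p : R * state | Tbar <= p.1 + j%:R /\ ~ inflate (sw_target (N := N) T) e p.2])) => j.
have clA : closed [set p : R * state | Tbar <= p.1 + j%:R].
  have -> : [set p : R * state | Tbar <= p.1 + j%:R] =
      fst @^-1` [set x | Tbar - j%:R <= x].
    by apply/seteqP; split => p /=; rewrite lerBlDr.
  by apply: closed_comp; [move=> p _; exact: cvg_fst | exact: closed_ge].
have clB : closed (snd @^-1` (~` inflate (sw_target (N := N) T) e) : set (R * state)).
  apply: closed_comp; first by move=> p _; exact: cvg_snd.
  by apply: open_closedC; exact: open_inflate.
exact: (closedI clA clB).
Qed.

(** On good inputs an excursion at time [s] on level [j] forces the discounted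
    Lyapunov function, which is largest at the start of the level, to reach
    the stated height there; the maximal inequality bounds the probability. *)
Lemma excursion_prob e Tbar : 0 < e ->
  ((expR (a * Tbar) * lo * e ^+ 2)%:E * P (excursion e Tbar) <= (V q0 y0)%:E)%E.
Proof.
move=> e0; set K := expR (a * Tbar) * lo * e ^+ 2.
have K0 : 0 <= K by rewrite !mulr_ge0 ?expR_ge0 ?exprn_ge0 ?ltW.
have V0 : 0 <= V q0 y0.
  apply: le_trans (lo_bound y0_mode).
  by rewrite mulr_ge0 ?slow_fast_sqnorm_ge0// ltW.
have [mN N0] := good_inputs_ae.
have vil := jump_process_ville iid weighted_end_ge0 measurable_weighted_end
  (fun q b => jump_weight_ge0 q b c_ge0) (fun q => measurable_jump_weight q c_ge0) V0 K0.
apply: le_trans vil; rewrite lee_wpmul2l ?lee_fin//.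
set hit := \bigcup_l _.
have sub : excursion e Tbar `<=` hit `|` ~` good_inputs.
  move=> w [[[s j] _] [[/= dom ->] [Ts far]]].
  have [good|] := pselect (good_inputs w); last by right.
  left; exists j => //=.
  have [t jt] := hybrid_time_domain_jump_times (arc_domP (y w)).
  have [_ _ level _] := jt; have [ts lev] := level _ _ dom.
  have [q [mq Uq]] := discounted_lyap_start good jt (lev _ (lexx _) ts).
  have [ms dec] := level_decay ts lev mq.
  have big : e ^+ 2 <= slow_fast_sqnorm (arc_val (y w) s j).
    by rewrite leNgt; apply/negP => small; apply: far; exact: inflate_target ms small.
  rewrite -/(discounted_lyap j w) Uq lee_fin.
  apply: (@le_trans _ _ (expR (a * (s + j%:R)) * V q (arc_val (y w) s j))); last first.
    rewrite !mulrDr !expRD !(mulrAC _ (expR (a * j%:R))).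
    by rewrite ler_pM2r ?expR_gt0.
  rewrite /K -mulrA ler_pM ?expR_ge0 ?mulr_ge0 ?exprn_ge0 ?(ltW lo_gt0) ?(ltW e0)//.
    by rewrite ler_expR ler_pM2l.
  by apply: le_trans (lo_bound ms); rewrite ler_pM2l.
have mhit : measurable hit.
  apply: bigcupT_measurable => l.
  have mX := @measurable_jump_process _ _ _ _ _ law v _ _ _ (V q0 y0)
    measurable_weighted_end (fun q => measurable_jump_weight q c_ge0) l.
  have := measurable_past_ambient mX measurableT (emeasurable_itv `[K%:E, +oo[%O).
  rewrite setTI; congr measurable; apply/seteqP.
  by split => w /=; rewrite in_itv/= andbT.
apply: (@le_trans _ _ (P (hit `|` ~` good_inputs))).
  by apply: le_measure; rewrite ?inE//; [exact: measurable_excursion | exact: measurableU].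
apply: (le_trans (measureU2 _ mhit mN)).
by rewrite [X in (_ + X)%E](_ : _ = 0%E) ?adde0//; exact: N0.
Qed.

End ExcursionBound.

Theorem proposition1 (R : realType) (N n n2 : nat) (T eta : R)
    (At : 'I_N -> 'M[R]_n) (B : 'I_N -> 'M[R]_(n, n2))
    (H : 'M[R]_(n2, n)) (L : 'M[R]_n2) (lambda : 'I_N -> R)
    (T_gt0 : 0 < T) (eta_ge0 : 0 <= eta)
    (lambda_ge0 : forall q, 0 <= lambda q)
    (lambda_sum1 : \sum_(q < N) lambda q = 1)
    (sigma : R) (Pm : 'I_N -> 'M[R]_n) (Pz : 'M[R]_n2)
    (sigma_gt0 : 0 < sigma)
    (Pm_posdef : forall q, posdefmx (Pm q)) (Pz_posdef : posdefmx Pz)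
    (lmi : let A q := At q - B q *m invmx L *m H in
           let Pbar := \sum_(q < N) lambda q *: Pm q in
           forall q,
           [/\ negdefmx ((A q)^T *m Pm q + Pm q *m A q
                         + (sigma * eta * T^-1) *: Pm q),
               negdefmx ((sigma^-1 * ln (1 + sigma)) *: Pbar - Pm q) &
               negdefmx (L^T *m Pz + Pz *m L)]) :
  exists2 eps_star : R, 0 < eps_star &
    forall eps : R, 0 < eps < eps_star ->
      UGASp (switched_shs eta eps At B H L lambda_ge0 lambda_sum1 T_gt0)
            (sw_target (N := N) T).
Proof.
have N_gt0 : (0 < N)%N.
  have [N0|//] := posnP N; move/eqP: lambda_sum1.
  rewrite big1 ?[0 == 1]eq_sym ?oner_eq0// => q _.
  by have := ltn_ord q; rewrite [X in (_ < X)%N]N0.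
pose i0 := Ordinal N_gt0.
have Lu : L \in unitmx by have [_ _] := lmi i0; exact: hurwitz_unit.
pose G := invmx L *m H; have LG : L *m G = H by rewrite mulmxA mulmxV ?mul1mx.
pose c := sigma / T; have c_gt0 : 0 < c by rewrite divr_gt0.
have cT : c * T = sigma by rewrite /c divfK// gt_eqF.
pose Pbar := \sum_(q < N) lambda q *: Pm q.
pose kappa := sigma^-1 * ln (1 + sigma).
have kappa01 : 0 <= kappa < 1 by exact: ln1D_div_lt1.
pose flow_ok q a eps := forall xi w,
  let xi' := (At q - B q *m G) *m xi + B q *m w in
  2 * bform (Pm q) xi xi' + 2 * bform Pz w (eps^-1 *: (L *m w) + G *m xi')
  + (a + c * eta) * (bform (Pm q) xi xi + bform Pz w w) <= 0.
pose jump_ok q a := expR a * kappa <= 1 /\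
  forall xi, expR a * kappa * bform Pbar xi xi <= bform (Pm q) xi xi.
(* One decay rate [a] must serve flows and jumps in all modes; the range of
   [eps] is chosen after it. *)
have [a a_gt0 Ha] : exists2 a, 0 < a & forall q,
    (exists2 e0, 0 < e0 & forall eps, 0 < eps <= e0 -> flow_ok q a eps) /\ jump_ok q a.
  have [a0 a00 Ha0] : exists2 a0, 0 < a0 & forall a, 0 < a <= a0 -> forall q,
      (exists2 e0, 0 < e0 & forall eps, 0 < eps <= e0 -> flow_ok q a eps) /\ jump_ok q a.
    apply: (small_uniform (P := fun q a =>
      (exists2 e0, 0 < e0 & forall eps, 0 < eps <= e0 -> flow_ok q a eps) /\ jump_ok q a)).
    move=> q; have [lmi_flow lmi_jump lmi_fast] := lmi q.
    have ceta : 0 <= c * eta by rewrite mulr_ge0// ltW.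
    have lmi_flow' : negdefmx ((At q - B q *m G)^T *m Pm q + Pm q *m (At q - B q *m G)
        + (c * eta) *: Pm q).
      by move: lmi_flow; rewrite /G /c mulmxA [sigma / T * eta]mulrAC.
    have [a1 a10 Hflow] := flow_rate (B q) G ceta (Pm_posdef q).1 Pz_posdef.1 lmi_flow' lmi_fast.
    have [a2 a20 Hjump] := jump_rate kappa01 lmi_jump.
    exists (Num.min a1 a2); first by rewrite lt_min a10.
    move=> a /andP[a0]; rewrite le_min => /andP[aa1 aa2]; split.
      by apply: Hflow; rewrite a0.
    by apply: Hjump; rewrite a0.
  by exists a0 => //; apply: Ha0; rewrite a00 lexx.
have [eps_star eps_star0 Heps] :=
  small_uniform (P := fun q eps => flow_ok q a eps) (fun q => (Ha q).1).
exists eps_star => // eps /andP[eps_gt0 eps_lt] d Omega P v iid.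
have rate q : flow_ok q a eps by apply: Heps; rewrite eps_gt0 ltW.
have jump_decay q s : expR a * ((c * T)^-1 * ln (1 + c * T)) *
    (\sum_i lambda i * energy G Pm Pz i s) <= energy G Pm Pz q s.
  have [_ [k1 kP]] := Ha q; rewrite cT -/kappa.
  have -> : \sum_i lambda i * energy G Pm Pz i s =
      bform Pbar (st_xi s) (st_xi s) + bform Pz (st_w G s) (st_w G s).
    rewrite bform_sum -[X in _ = _ + X]mul1r -lambda_sum1 mulr_suml -big_split/=.
    by apply: eq_bigr => i _; rewrite bformZm mulrDr.
  rewrite mulrDr lerD//.
  by rewrite ler_piMl// posdefmx_ge0.
have [lo lo_gt0 [hi hi_gt0 bounds]] :=
  lyap_bounds G Pm_posdef Pz_posdef (ltW T_gt0) (ltW c_gt0).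
pose sys := switched_shs eta eps At B H L lambda_ge0 lambda_sum1 T_gt0.
pose target := sw_target (N := N) (n := n) (n2 := n2) T.
have key e rho r Tbar y0 y : 0 < e -> 0 < rho ->
    hi * r ^+ 2 <= rho * (expR (a * Tbar) * lo * e ^+ 2) ->
    initial_within sys target r y0 -> random_solution sys v y0 y ->
    ((1 - rho)%:E <= P (~` excursion (N := N) T y e Tbar))%E.
  move=> e0 rho0 hr [y0CD y0r] sol.
  have [q0 my0] : exists q0 : 'I_N, in_mode T q0 y0.
    case: y0CD => [[[q mq] tT]|[[q mq] t0]]; exists q; split => //.
    by rewrite t0 lexx ltW.
  have lo_bound q s : in_mode T q s -> lo * slow_fast_sqnorm s <= lyap G Pm Pz c q s.
    by move=> /bounds/andP[].
  have prob := excursion_prob eps_gt0 c_gt0 a_gt0 Pm_posdef Pz_posdef LG rate jump_decay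
    iid my0 sol lo_gt0 lo_bound Tbar e0.
  have mexc := measurable_excursion sol Tbar e0.
  have K0 : 0 < expR (a * Tbar) * lo * e ^+ 2 by rewrite !mulr_gt0 ?expR_gt0 ?exprn_gt0.
  have V0 : lyap G Pm Pz c q0 y0 <= hi * r ^+ 2.
    have /andP[_ /le_trans] := bounds _ _ my0; apply; rewrite ler_pM2l//.
    rewrite -(sqr_sqrtr (slow_fast_sqnorm_ge0 y0)).
    have sr : Num.sqrt (slow_fast_sqnorm y0) <= r.
      exact: le_trans (edist_target_ge (ltW T_gt0) y0 i0) y0r.
    by rewrite ler_sqr ?nnegrE ?sqrtr_ge0// (le_trans _ sr) ?sqrtr_ge0.
  rewrite probability_setC//.
  have fP : P (excursion (N := N) T y e Tbar) \is a fin_num by exact: fin_num_measure.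
  rewrite -(fineK fP) -EFinB lee_fin lerB//.
  move: prob; rewrite -(fineK fP) -EFinM lee_fin => prob.
  rewrite -(ler_pM2l K0); apply: (le_trans prob); rewrite mulrC.
  exact: le_trans V0 hr.
have staysE e Tbar (y : Omega -> hybrid_arc R _) :
    [set w | forall t j, arc_dom (y w) (t, j) -> Tbar <= t + j%:R ->
       inflate target e (arc_val (y w) t j)] = ~` excursion (N := N) T y e Tbar.
  apply/seteqP; split => w /=.
    by move=> near_ [[[t j] s] [[/= dom ->] [Tt far]]]; apply: far; exact: near_.
  move=> noexc t j dom Tt; apply: contrapT => far; apply: noexc.
  by exists (t, j, arc_val (y w) t j).
have alwaysE e (y : Omega -> hybrid_arc R _) :
    [set w | forall t j, arc_dom (y w) (t, j) ->
       inflate target e (arc_val (y w) t j)] = ~` excursion (N := N) T y e 0.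
  rewrite -staysE; apply/seteqP; split => w /= near_ t j dom; first by move=> _; exact: near_.
  apply: near_ => //; rewrite addr_ge0//.
  have [s [s0 sS level _]] := hybrid_time_domain_jump_times (arc_domP (y w)).
  have s_ge0 k : 0 <= s k by elim: k => [|k IH]; [rewrite s0 | exact: le_trans (sS k)].
  by have [st _] := level _ _ dom; exact: le_trans st.
split.
- move=> e rho e0 rho0.
  exists (Num.sqrt (rho * (lo * e ^+ 2) / hi)).
    by rewrite sqrtr_gt0 !(divr_gt0, mulr_gt0, exprn_gt0).
  move=> y0 y y0r [sol _]; rewrite /always_near alwaysE.
  apply: key y0r sol => //; rewrite mulr0 expR0 mul1r sqr_sqrtr.
    by rewrite mulrC divfK// gt_eqF.
  by rewrite ltW// !(divr_gt0, mulr_gt0, exprn_gt0).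
- move=> r rho r0 rho0.
  exists (Num.sqrt (hi * r ^+ 2 / (rho * lo))).
    by rewrite sqrtr_gt0 !(divr_gt0, mulr_gt0, exprn_gt0).
  move=> y0 y y0r [sol _]; rewrite /always_near alwaysE.
  apply: key y0r sol => //.
    by rewrite sqrtr_gt0 !(divr_gt0, mulr_gt0, exprn_gt0).
  rewrite mulr0 expR0 mul1r sqr_sqrtr.
    by rewrite [leRHS]mulrA [leRHS]mulrC divfK// gt_eqF// mulr_gt0.
  by rewrite ltW// !(divr_gt0, mulr_gt0, exprn_gt0).
- move=> e rho r e0 rho0 r0.
  pose X := hi * r ^+ 2 / (rho * (lo * e ^+ 2)).
  have X0 : 0 <= X by rewrite ltW// !(divr_gt0, mulr_gt0, exprn_gt0).
  (* At time X / a the discount is exp X >= X, which pays for the initial value. *)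
  exists (X / a); first by rewrite divr_ge0// ltW.
  move=> y0 y y0r sol; rewrite /stays_near staysE.
  apply: key y0r sol => //.
  have -> : a * (X / a) = X by rewrite mulrC divfK// gt_eqF.
  have D0 : 0 < rho * (lo * e ^+ 2) by rewrite !mulr_gt0// exprn_gt0.
  have -> : rho * (expR X * lo * e ^+ 2) = expR X * (rho * (lo * e ^+ 2)) by ring.
  rewrite -ler_pdivrMr// -/X.
  by have := expR_ge1Dx X; lra.
Qed.
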